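(* Let $K$ be an abelian group and let $p:\pi=\pi_1(\Sigma,* )\to K$ be a $K$-marking, where $\Sigma=\Sigma_{g,1}$, $g\ge 1$. Then the cochains $m^p\in C^1(\hat{\mathcal G}(\Sigma);K)$, $j^p\in C^1(\hat{\mathcal G}(\Sigma);\Lambda^3K)$ and $s^p\in C^1(\hat{\mathcal G}(\Sigma);S^2\Lambda^2K)$ are $MC_\Box(\Sigma;p)$-equivariant cocycles on $\hat{\mathcal G}(\Sigma)$. In particular, they descend to $1$-cocycles on the cell complex $\hat M_\nabla(\Sigma;p)=\hat{\mathcal G}(\Sigma)/MC_\nabla(\Sigma;p)$ with the corresponding coefficients.
   Context: **Surface and mapping class group.** $\Sigma=\Sigma_{g,1}$ is a compact oriented smooth surface of genus $g\ge1$ with one boundary component and basepoint $*\in\partial\Sigma$; $\pi=\pi_1(\Sigma,* )$; $MC(\Sigma)$ is the group of isotopy classes of diffeomorphisms of $\Sigma$ fixing $\partial\Sigma$ pointwise, identified (Dehn–Nielsen) with the subgroup of $\mathrm{Aut}(\pi)$ fixing $\zeta$, the class of $\partial\Sigma$ with orientation opposite to the one induced from $\Sigma$. **Markings on $\pi$.** A $K$-marking is an epimorphism $p:\pi\to K$. $MC_\nabla(\Sigma;p)=\{\varphi\in MC(\Sigma): p\circ\varphi=p\}$ and $MC_\Box(\Sigma;p)=\{\varphi\in MC(\Sigma):\varphi(\ker p)=\ker p\}$. Each $\varphi\in MC_\Box(\Sigma;p)$ induces $\tilde\varphi\in\mathrm{Aut}(K)$ with $p\circ\varphi=\tilde\varphi\circ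 p$; this gives an action of $MC_\Box(\Sigma;p)$ on $K$, hence on $\Lambda^3K$ and on $S^2\Lambda^2K$ (symmetric tensors in $\Lambda^2K\otimes\Lambda^2K$). **Fatgraph spines.** A fatgraph $G$ (with tail) is a finite connected graph, all of whose vertices have valence at least $3$ except a single univalent vertex (whose incident edge is the tail), with a cyclic ordering of the half-edges at each vertex. $\tilde E(G)$ is the set of oriented edges, with orientation reversal $e\mapsto\bar e$; a half-edge incident on a vertex $v$ is identified with its ambient edge oriented towards $v$. A fatgraph spine of $\Sigma$ is a fatgraph $G$ together with the isotopy class relative to the boundary of an embedding $i:G\to\Sigma$ whose image is a strong deformation retract of $\Sigma$, such that the cyclic orderings agree with the counterclockwise sense in $\Sigma$ and $i^{-1}(\partial\Sigma)=i^{-1}(\partial\Sigma\setminus\{*\})$ is the univalent vertex. $MC(\Sigma)$ acts on spines by $\varphi\cdot(G,i)=(G,\varphi\circ i)$. A spine determines a map $\mu:\tilde E(G)\to\pi$: for $e\in\tilde E(G)$ take a small arc $\alpha_e$ transverse to $e$, oriented so that (tangent of $\alpha_e$, tangent of $e$) is a positively oriented basis, and join the endpoints of $\alpha_e$ to $*$ by paths in the contractible complement $\Sigma\setminus i(G)$; $\mu(e)$ is the class of the resulting loop. Then $\mu(\bar e)=\mu(e)^{-1}$, and $\mu(e_1)\cdots\mu(e_k)=1$ if $e_1,\dots,e_k$ are the half-edges (oriented towards the vertex) at a vertex, in a linear order compatible with the cyclic order. For an oriented edge $e$ write $p(e)=p(\mu(e))\in K$. **Flips.** A flip $W$ on a trivalent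 spine $G$ along a non-tail edge $e$ with distinct endpoints collapses $e$ to a $4$-valent vertex and expands that vertex in the other possible way, producing a trivalent spine $G'$ with a new edge $e'$. Notation: $a,b,c,d$ are the four half-edges at the $4$-valent vertex, oriented towards it and listed in the counterclockwise cyclic order, such that in $G$ the edge $e$ joins the vertex incident on $a,b$ to the vertex incident on $c,d$ (and in $G'$ the edge $e'$ joins the vertex incident on $d,a$ to the vertex incident on $b,c$). The markings of all other edges are unchanged, and the new marking of $e'$ is $\mu'(e')=\mu(d)\mu(a)=\mu(\bar c)\mu(\bar b)$, when $e'$ is oriented towards the vertex incident on $b,c$. The labelling is determined up to exchanging $(a,b,c,d)$ with $(c,d,a,b)$. **The complex $\hat{\mathcal G}(\Sigma)$.** $\hat{\mathcal G}(\Sigma)$ is the dual fatgraph complex, i.e. the dual CW-complex of the $MC(\Sigma)$-invariant ideal simplicial decomposition of Teichmüller space whose cells are indexed by fatgraph spines, with face relation given by contraction of non-tail edges with distinct endpoints. Its vertices are the trivalent fatgraph spines; its oriented $1$-cells are the flips (a flip and its inverse flip being the two orientations of the same $1$-cell); its $2$-cells correspond to spines that are trivalent except for either two $4$-valent vertices (boundary: commutativity of two flips along disjoint edges) or one $5$-valent vertex (boundary: the pentagon of five successive flips along two edges sharing a single endpoint and their corresponding edges, containing no involutive pair of flips). $MC(\Sigma)$ acts freely on $\hat{\mathcal G}(\Sigma)$. **The cochains.** With $K$ written additively and the notation above for a flip $W$: $$m^p(W)=p(a)+p(c)\in K,\qquad j^p(W)=p(a)\wedge p(b)\wedge p(c)\in\Lambda^3K,$$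 $$s^p(W)=[p(a)\wedge p(c)]\otimes[p(b)\wedge p(d)]+[p(b)\wedge p(d)]\otimes[p(a)\wedge p(c)]\in S^2\Lambda^2K.$$ A $1$-cochain $c$ on $\hat{\mathcal G}(\Sigma)$ with values in one of these groups is $MC_\Box(\Sigma;p)$-equivariant if $c(\varphi(\sigma))=\varphi(c(\sigma))$ for every oriented $1$-cell $\sigma$ and every $\varphi\in MC_\Box(\Sigma;p)$. Being a cocycle includes that the values are well defined, change sign under reversal of the $1$-cell, and sum to zero around the boundary of each $2$-cell. *)

(* Defs.v *)
From HB Require Import structures.
From mathcomp Require Import all_boot all_order all_algebra.
From mathcomp Require Import boolp classical_sets.
From mathcomp Require Import freeg.

Set Implicit Arguments.
Unset Strict Implicit.
Unset Printing Implicit Defensive.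

Import GRing.Theory.
Local Open Scope quotient_scope.
Local Open Scope ring_scope.

(** * Multilinear algebra over the integers *)

Section Presentation.
Variables (T : choiceType) (rel : set {freeg T}).

Definition relation_span : {pred {freeg T}} := fun x =>
  `[< forall S : set {freeg T}, S 0 -> (forall y z, S y -> S z -> S (y - z)) ->
      (rel `<=` S)%classic -> S x >].

Lemma relation_span_closed : zmod_closed relation_span.
Proof.
split; rewrite /in_mem /=; first by apply/asboolP => S S0.
move=> x y; rewrite /in_mem /= => /asboolP hx /asboolP hy.
rewrite /in_mem /=; apply/asboolP => S S0 SB relS.
by apply: (SB); [exact: (hx S) | exact: (hy S)].
Qed.

HB.instance Definition _ :=
  GRing.isZmodClosed.Build {freeg T} relation_span relation_span_closed.

(* The abelian group with generators [T] and relators [rel]. *)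
Definition presented : Type := Quotient.quot relation_span.
HB.instance Definition _ := GRing.Zmodule.on presented.

Definition gen (t : T) : presented := \pi_(Quotient.quot relation_span) << t >>.

Section Lift.
Variables (A : zmodType) (f : T -> A).

Definition free_lift (x : {freeg T}) : A := fglift (f : T -> ssrint.zmodule A) x.

(* The homomorphism extending [f]; meaningful when [f] kills the relators. *)
Definition presented_lift (q : presented) : A :=
  free_lift (@repr _ (Quotient.quot relation_span) q).

Lemma free_liftB x y : free_lift (x - y) = free_lift x - free_lift y.
Proof. exact: (lift_is_additive (f : T -> ssrint.zmodule A)). Qed.

Lemma free_liftU t : free_lift << t >> = f t.
Proof. by rewrite /free_lift liftU scale1r. Qed.

Hypothesis f_rel : forall x, rel x -> free_lift x = 0.

Lemma presented_lift_pi x :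
  presented_lift (\pi_(Quotient.quot relation_span) x) = free_lift x.
Proof.
rewrite /presented_lift; apply/eqP; rewrite -subr_eq0 -free_liftB; apply/eqP.
have: @repr _ (Quotient.quot relation_span) (\pi_(Quotient.quot relation_span) x) - x
        \in relation_span.
  by rewrite Quotient.idealrBE reprK.
move/asboolP/(_ (fun y => free_lift y = 0)); apply; last exact: f_rel.
- by rewrite -[X in free_lift X](subrr 0) free_liftB subrr.
- by move=> y z y0 z0; rewrite free_liftB y0 z0 subrr.
Qed.

Lemma presented_lift_gen t : presented_lift (gen t) = f t.
Proof. by rewrite /gen presented_lift_pi free_liftU. Qed.

Lemma presented_lift_is_additive : zmod_morphism presented_lift.
Proof.
move=> x y; rewrite -[x]reprK -[y]reprK -[in LHS]raddfB.
by rewrite !presented_lift_pi free_liftB.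
Qed.

End Lift.

End Presentation.
Arguments gen {T rel} t.

Lemma presented_ext (T : choiceType) (rel : set {freeg T}) (A : zmodType)
    (u v : {additive presented rel -> A}) :
  (forall t, u (gen t) = v (gen t)) -> u =1 v.
Proof.
move=> uv q.
pose pr := \pi_(Quotient.quot (relation_span rel)) : {additive _ -> _}.
have -> : q = pr (@repr _ (Quotient.quot (relation_span rel)) q).
  by rewrite /pr /= reprK.
elim/freeg_ind_dom0: (@repr _ _ q) => [|k t D _ _ IH]; first by rewrite !raddf0.
rewrite !raddfD IH; congr (_ + _).
have -> : << k *g t >> = << t >> *~ k :> {freeg T}.
  by rewrite freegU_mulz intz.
by rewrite !raddfMz /= -/(gen t) uv.
Qed.

Arguments presented_lift {T rel A} f q.

Lemma genB_rel (T : choiceType) (rel : set {freeg T}) u v w :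
  rel (<< u >> - << v >> - << w >>) -> gen u = gen v + gen w :> presented rel.
Proof.
move=> r; pose q := \pi_(Quotient.quot (relation_span rel)) : {additive _ -> _}.
suff: q (<< u >> - << v >> - << w >>) = 0.
  rewrite !raddfB -addrA -opprD => /eqP; rewrite subr_eq0 => /eqP; exact.
rewrite -[RHS](raddf0 q); apply/eqP; rewrite -Quotient.idealrBE subr0.
by apply/asboolP => S _ _; exact.
Qed.

Section Tensor.
Variables A B : zmodType.

Definition tensor_rel : set {freeg A * B} := (fun r =>
  (exists a a' b, r = << (a + a', b) >> - << (a, b) >> - << (a', b) >>) \/
  (exists a b b', r = << (a, b + b') >> - << (a, b) >> - << (a, b') >>)).

Definition tensor : Type := presented tensor_rel.
HB.instance Definition _ := GRing.Zmodule.on tensor.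

Definition tens (a : A) (b : B) : tensor := gen (a, b).

Lemma tensDl (a a' : A) (b : B) : tens (a + a') b = tens a b + tens a' b.
Proof. by apply: genB_rel; left; exists a, a', b. Qed.

Lemma tensDr (a : A) (b b' : B) : tens a (b + b') = tens a b + tens a b'.
Proof. by apply: genB_rel; right; exists a, b, b'. Qed.

End Tensor.

Section TensorMap.
Variables (A B A' B' : zmodType) (f : {additive A -> A'}) (h : {additive B -> B'}).

Definition tensor_map : tensor A B -> tensor A' B' :=
  presented_lift (fun ab : A * B => tens (f ab.1) (h ab.2)).

Let map_rel r : tensor_rel r ->
  free_lift (fun ab : A * B => tens (f ab.1) (h ab.2)) r = 0.
Proof.
by case=> [[a [a' [b ->]]]|[a [b [b' ->]]]];
  rewrite !free_liftB !free_liftU /= raddfD (tensDl, tensDr) -addrA -opprD subrr.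
Qed.

HB.instance Definition _ := GRing.isZmodMorphism.Build _ _ tensor_map
  (presented_lift_is_additive map_rel).

Lemma tensor_map_tens a b : tensor_map (tens a b) = tens (f a) (h b).
Proof. exact: presented_lift_gen. Qed.

End TensorMap.

Section Swap.
Variables A B : zmodType.

Definition tensor_swap : tensor A B -> tensor B A :=
  presented_lift (fun ab : A * B => tens ab.2 ab.1).

Let swap_rel r : tensor_rel r -> free_lift (fun ab : A * B => tens ab.2 ab.1) r = 0.
Proof.
by case=> [[a [a' [b ->]]]|[a [b [b' ->]]]];
  rewrite !free_liftB !free_liftU /= (tensDl, tensDr) -addrA -opprD subrr.
Qed.

HB.instance Definition _ := GRing.isZmodMorphism.Build _ _ tensor_swap
  (presented_lift_is_additive swap_rel).

Lemma tensor_swap_tens a b : tensor_swap (tens a b) = tens b a.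
Proof. exact: presented_lift_gen. Qed.

End Swap.


(** Symmetric tensors *)

Section SymmetricTensors.
Variable A : zmodType.

Definition is_symmetric : {pred tensor A A} := fun x => tensor_swap x == x.

Lemma is_symmetric_closed : zmod_closed is_symmetric.
Proof.
split=> [|x y]; rewrite /in_mem /= /is_symmetric ?raddf0 // => /eqP sx.
by rewrite /in_mem /= /is_symmetric raddfB => /eqP sy; rewrite /= sx sy.
Qed.

HB.instance Definition _ :=
  GRing.isZmodClosed.Build (tensor A A) is_symmetric is_symmetric_closed.

Record sym_tensor : Type := SymTensor {
  sym_val :> tensor A A;
  _ : sym_val \in is_symmetric }.

HB.instance Definition _ := [isSub for sym_val].
HB.instance Definition _ := [Choice of sym_tensor by <:].
HB.instance Definition _ := [SubChoice_isSubZmodule of sym_tensor by <:].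

Lemma sym_prod_subproof u v : tens u v + tens v u \in is_symmetric.
Proof.
by rewrite /in_mem /= /is_symmetric raddfD /= !tensor_swap_tens addrC.
Qed.

Definition sym_prod u v : sym_tensor := SymTensor (sym_prod_subproof u v).

End SymmetricTensors.

Section SymMap.
Variables (A B : zmodType) (f : {additive A -> B}).

Lemma sym_map_subproof (x : sym_tensor A) : tensor_map f f x \in @is_symmetric B.
Proof.
case: x => x; rewrite /in_mem /= /is_symmetric => /eqP sx; apply/eqP.
rewrite -[in RHS]sx.
apply: (presented_ext
  (u := (@tensor_swap B B \o tensor_map f f)%FUN)
  (v := (tensor_map f f \o @tensor_swap A A)%FUN) _ x) => -[a b] /=.
by rewrite -/(tens a b) !(tensor_swap_tens, tensor_map_tens).
Qed.

Definition sym_map (x : sym_tensor A) : sym_tensor B :=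
  SymTensor (sym_map_subproof x).

End SymMap.

(** Exterior powers *)

Section Exterior.
Variables (n : nat) (A : zmodType).

Definition subst (a : {ffun 'I_n -> A}) (i : 'I_n) (x : A) : {ffun 'I_n -> A} :=
  [ffun k => if k == i then x else a k].

Definition ext_rel : set {freeg {ffun 'I_n -> A}} := (fun r =>
  (exists a i x y, r = << subst a i (x + y) >> - << subst a i x >>
                       - << subst a i y >>) \/
  (exists a : {ffun 'I_n -> A}, (exists i j, i != j /\ a i = a j) /\ r = << a >>)).

Definition ext : Type := presented ext_rel.
HB.instance Definition _ := GRing.Zmodule.on ext.

Definition wedge (a : {ffun 'I_n -> A}) : ext := gen a.

Lemma wedgeD a i x y :
  wedge (subst a i (x + y)) = wedge (subst a i x) + wedge (subst a i y).
Proof. by apply: genB_rel; left; exists a, i, x, y. Qed.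

Lemma wedge_alt (a : {ffun 'I_n -> A}) i j : i != j -> a i = a j -> wedge a = 0.
Proof.
move=> ij aij; pose q := \pi_(Quotient.quot (relation_span ext_rel)) : {additive _ -> _}.
rewrite /wedge /gen -[RHS](raddf0 q); apply/eqP; rewrite -Quotient.idealrBE subr0.
by apply/asboolP => S _ _; apply; right; exists a; split=> //; exists i, j.
Qed.

End Exterior.

Section ExtMap.
Variables (n : nat) (A B : zmodType) (f : {additive A -> B}).

Definition ext_map : ext n A -> ext n B :=
  presented_lift (fun a : {ffun 'I_n -> A} => wedge [ffun i => f (a i)]).

Let map_rel r : @ext_rel n A r ->
  free_lift (fun a : {ffun 'I_n -> A} => wedge [ffun i => f (a i)]) r = 0.
Proof.
case=> [[a [i [x [y ->]]]]|[a [[i [j [ij aij]]] ->]]]; last first.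
  by rewrite free_liftU; apply: (@wedge_alt _ _ _ i j ij); rewrite !ffunE aij.
have E z : [ffun k => f (subst a i z k)] = subst [ffun k => f (a k)] i (f z).
  by apply/ffunP => k; rewrite !ffunE; case: ifP.
by rewrite !free_liftB !free_liftU !E raddfD wedgeD -addrA -opprD subrr.
Qed.

HB.instance Definition _ := GRing.isZmodMorphism.Build _ _ ext_map
  (presented_lift_is_additive map_rel).

Lemma ext_map_wedge a : ext_map (wedge a) = wedge [ffun i => f (a i)].
Proof. exact: presented_lift_gen. Qed.

End ExtMap.

Section SmallWedges.
Variable A : zmodType.
Definition wedge2 (x y : A) : ext 2 A := wedge [ffun i : 'I_2 => [:: x; y]`_i].
Definition wedge3 (x y z : A) : ext 3 A := wedge [ffun i : 'I_3 => [:: x; y; z]`_i].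
End SmallWedges.

Local Close Scope ring_scope.
Local Close Scope quotient_scope.

(** * Free groups *)

Section FreeGroup.
Variable X : choiceType.
Local Open Scope group_scope.

(* The letter [(x, true)] is the generator [x], and [(x, false)] its inverse. *)
Definition letter : Type := (X * bool)%type.
HB.instance Definition _ := Choice.on letter.

Definition linv (u : letter) : letter := (u.1, ~~ u.2).

Definition reduced_word (w : seq letter) : bool :=
  sorted (fun u v => v != linv u) w.

Definition push (u : letter) (w : seq letter) : seq letter :=
  if w is v :: w' then if v == linv u then w' else u :: w else [:: u].

Record free_group : Type := FreeGroup {
  word :> seq letter;
  word_reduced : reduced_word word }.

HB.instance Definition _ := [isSub for word].
HB.instance Definition _ := [Choice of free_group by <:].

Lemma linvK : involutive linv. Proof. by case=> x b; rewrite /linv /= negbK. Qed.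

Lemma push_reduced u w : reduced_word w -> reduced_word (push u w).
Proof.
case: w => [//|v w] /= pw; case: ifPn => [_|vu] /=; first exact: path_sorted pw.
by rewrite vu.
Qed.

Lemma foldr_push_reduced w1 w2 :
  reduced_word w2 -> reduced_word (foldr push w2 w1).
Proof. by move=> r2; elim: w1 => //= u w1; apply: push_reduced. Qed.

Lemma push_linv u w : reduced_word w -> push u (push (linv u) w) = w.
Proof.
case: w => [|v w] /=; first by rewrite eqxx.
rewrite linvK; case: eqP => [-> /=|_ _ /=]; last by rewrite eqxx.
by case: w => [//|v' w] /= /andP[/negbTE->].
Qed.

Lemma foldr_push u w1 w2 : reduced_word w2 -> reduced_word w1 ->
  foldr push w2 (push u w1) = push u (foldr push w2 w1).
Proof.
move=> r2; case: w1 => [//|v w1] /= r1; case: eqP => [->|//].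
by rewrite push_linv // foldr_push_reduced.
Qed.

Lemma foldr_push_id w : reduced_word w -> foldr push [::] w = w.
Proof.
elim: w => //= u w IH uw; rewrite (IH (path_sorted uw)).
by case: w uw {IH} => //= v w /andP[/negbTE->].
Qed.

Lemma foldr_pushA w1 w2 w3 : reduced_word w2 -> reduced_word w3 ->
  foldr push w3 (foldr push w2 w1) = foldr push (foldr push w3 w2) w1.
Proof.
move=> r2 r3; elim: w1 => //= u w1 <-.
by rewrite foldr_push // foldr_push_reduced.
Qed.

Definition winv (w : seq letter) : seq letter := rev (map linv w).

Lemma winvK : involutive winv.
Proof. by move=> w; rewrite /winv map_rev revK -map_comp map_id_in // => u _; apply: linvK. Qed.

Lemma winv_reduced w : reduced_word w -> reduced_word (winv w).
Proof.
rewrite /reduced_word /winv rev_sorted sorted_map; apply: sub_sorted => u v /=.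
by apply: contraNneq => ->; rewrite linvK.
Qed.

Lemma foldr_push_winv w : reduced_word w -> foldr push w (winv w) = [::].
Proof.
suff H w2 : reduced_word (w ++ w2) -> foldr push (w ++ w2) (winv w) = w2.
  by move=> rw; rewrite -[X in foldr push X _]cats0 H ?cats0.
elim: w => //= u w IH /= r; rewrite /winv /= rev_cons foldr_rcons /= linvK eqxx.
exact/IH/(path_sorted r).
Qed.

Definition fg_one := @FreeGroup [::] isT.
Definition fg_mul (x y : free_group) :=
  FreeGroup (foldr_push_reduced x (word_reduced y)).
Definition fg_inv (x : free_group) := FreeGroup (winv_reduced (word_reduced x)).

Lemma fg_mulA : associative fg_mul.
Proof.
move=> x y z; apply: val_inj => /=.
by rewrite foldr_pushA ?word_reduced.
Qed.
Lemma fg_mul1 : left_id fg_one fg_mul.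
Proof. by move=> x; apply: val_inj. Qed.
Lemma fg_1mul : right_id fg_one fg_mul.
Proof. by move=> x; apply: val_inj; rewrite /= foldr_push_id ?word_reduced. Qed.
Lemma fg_mulV : left_inverse fg_one fg_inv fg_mul.
Proof. by move=> x; apply: val_inj; rewrite /= foldr_push_winv ?word_reduced. Qed.
Lemma fg_Vmul : right_inverse fg_one fg_inv fg_mul.
Proof.
move=> x; apply: val_inj; rewrite /= -[X in foldr _ _ X](winvK x).
by rewrite foldr_push_winv ?winv_reduced ?word_reduced.
Qed.

HB.instance Definition _ := isGroup.Build free_group
  fg_mulA fg_mul1 fg_1mul fg_mulV fg_Vmul.

Definition free_gen (x : X) : free_group := @FreeGroup [:: (x, true)] isT.

End FreeGroup.

(** * The surface and its mapping class group *)

(* The fundamental group of the surface of genus [g] with one boundary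
   component, free on standard generators alpha_i, beta_i. *)
Definition surface_group (g : nat) : Type := free_group ('I_g * bool)%type.
HB.instance Definition _ g := Group.on (surface_group g).

Definition alpha g (i : 'I_g) : surface_group g := free_gen (i, true).
Definition beta g (i : 'I_g) : surface_group g := free_gen (i, false).

(* The boundary loop, with orientation opposite to the induced one.  Which of
   a product of commutators and its inverse is taken does not matter: an
   automorphism of the free group exchanges them. *)
Definition zeta g : surface_group g :=
  (\prod_(i < g) (alpha i * beta i * (alpha i)^-1 * (beta i)^-1))%g.

(* The mapping class group, as the group of automorphisms fixing [zeta]
   (Dehn-Nielsen). *)
Record mapping_class (g : nat) : Type := MappingClass {
  mc_fun :> surface_group g -> surface_group g;
  mc_mul : {morph mc_fun : x y / (x * y)%g};
  mc_bij : bijective mc_fun;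
  mc_zeta : mc_fun (zeta g) = zeta g }.

Lemma mc1 g (phi : mapping_class g) : phi 1%g = 1%g.
Proof. by apply: (mulgI (phi 1%g)); rewrite -mc_mul !mulg1. Qed.

Lemma mcV g (phi : mapping_class g) x : phi x^-1%g = (phi x)^-1%g.
Proof. by apply: (mulgI (phi x)); rewrite -mc_mul !mulgV mc1. Qed.

(** * Fatgraph spines *)

(* Half-edges are identified with oriented edges pointing to their vertex;
   [bar] reverses the orientation, [nxt] is the counterclockwise successor at
   the vertex, so that vertices are the orbits of [nxt].  [tail] is the tail,
   oriented towards the univalent vertex.  The set of half-edges is a finite
   ordinal; fatgraphs are considered up to isomorphism below. *)
Record fatgraph : Type := Fatgraph {
  ndart : nat;
  bar : 'I_ndart -> 'I_ndart;
  nxt : 'I_ndart -> 'I_ndart;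
  tail : 'I_ndart;
  barK : involutive bar;
  bar_neq : forall e, bar e != e;
  nxt_inj : injective nxt;
  nxt_tail : nxt tail = tail;
  valence : forall e, e != tail -> 3 <= order nxt e;
  fatgraph_connected : forall e f,
    connect [rel x y | (y == bar x) || (y == nxt x)] e f }.

Notation dart G := 'I_(ndart G).

Arguments bar {f} : rename.
Arguments nxt {f} : rename.
Arguments tail {f} : rename.

(* The boundary components of the surface obtained by thickening [G] are the
   orbits of [bar \o nxt]. *)
Definition one_boundary (G : fatgraph) : Prop :=
  forall e f : dart G, fconnect (bar \o nxt) e f.

(* Euler characteristic: #vertices - #edges = 1 - 2g. *)
Definition has_genus (g : nat) (G : fatgraph) : Prop :=
  fcard nxt (dart G) + 2 * g = fcard bar (dart G) + 1.

Definition generates (pi : groupType) (I : Type) (m : I -> pi) : Prop :=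
  forall S : set pi, S 1%g -> (forall x y, S x -> S y -> S (x * y)%g) ->
    (forall x, S x -> S x^-1%g) -> (forall i, S (m i)) -> forall x, S x.

(* A fatgraph spine, recorded by the underlying fatgraph and the map [mark]
   from oriented edges to the fundamental group.  The conditions on [mark] say
   that it is induced by an identification of the fundamental group of the
   thickening of the graph with [surface_group g] that preserves the boundary
   loop; by the Dehn-Nielsen theorem this is the same as an isotopy class of
   embeddings of the graph as a spine.  The tail oriented towards the boundary
   is crossed by the loop [zeta]. *)
Record spine (g : nat) : Type := Spine {
  graph :> fatgraph;
  spine_boundary : one_boundary graph;
  spine_genus : has_genus g graph;
  mark : dart graph -> surface_group g;
  mark_bar : forall e, mark (bar e) = ((mark e)^-1)%g;
  mark_vertex : forall e, e != tail ->
    (\prod_(h <- orbit nxt e) mark h)%g = 1%g;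
  mark_generates : generates mark;
  mark_tail : mark tail = zeta g }.

Definition trivalent (G : fatgraph) : Prop :=
  forall e : dart G, e != tail -> order nxt e = 3.

(* Same spine: isomorphic fatgraphs, with isotopic embeddings. *)
Record spine_iso g (G H : spine g) : Type := SpineIso {
  iso_fun :> dart G -> dart H;
  iso_bij : bijective iso_fun;
  iso_bar : {morph iso_fun : e / bar e};
  iso_nxt : {morph iso_fun : e / nxt e};
  iso_tail : iso_fun tail = tail;
  iso_mark : forall e, mark (iso_fun e) = mark e }.

(** * Flips *)

(* The number of coincidences between an endpoint of [x] and one of [y]. *)
Definition shared (D : finType) (bar nxt : D -> D) (x y : D) : nat :=
  count (fun uv => fconnect nxt uv.1 uv.2)
    [seq (u, v) | u <- [:: x; bar x], v <- [:: y; bar y]].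

Section FlipFunctions.
Variables (D : finType) (bar nxt : D -> D) (t x : D).

(* [x] is not the tail edge, and its edge has distinct endpoints. *)
Definition flippable : bool :=
  [&& x != t, bar x != t & ~~ fconnect nxt x (bar x)].

Let a := nxt x.
Let b := nxt a.
Let c := nxt (bar x).
Let d := nxt c.

(* In a trivalent graph the vertices (a, b, x), (c, d, bar x) are replaced by
   (d, a, bar x), (b, c, x); the new edge, still called [x], points to the
   vertex incident on b, c. *)
Definition flip_nxt (h : D) : D :=
  if h == d then a else if h == a then bar x else if h == bar x then d else
  if h == b then c else if h == c then x else if h == x then b else nxt h.

Definition flip_mark (pi : groupType) (mu : D -> pi) (h : D) : pi :=
  (if h == x then mu d * mu a else
   if h == bar x then (mu d * mu a)^-1 else mu h)%g.

Hypotheses (barK : involutive bar) (bar_neq : forall e, bar e != e).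
Hypotheses (nxt_inj : injective nxt) (nxt_tail : nxt t = t).
Hypothesis triv : forall e, e != t -> order nxt e = 3.
Hypothesis flipx : flippable.

Lemma order3 (f : D -> D) e : injective f -> f (f (f e)) = e -> f e != e ->
  order f e = 3 /\ orbit f e = [:: e; f e; f (f e)].
Proof.
move=> fI fe ne.
suff o : order f e = 3 by split=> //; rewrite /orbit o.
apply: (@order_cycle _ f [:: e; f e; f (f e)]); rewrite ?inE ?eqxx //=.
  by rewrite !eqxx fe eqxx.
rewrite !inE negb_or eq_sym ne andbT /=; apply/andP; split.
  by apply: contraNneq ne => E; rewrite -{2}fe -E.
by rewrite inj_eq // eq_sym.
Qed.

Lemma trivP e : e != t -> nxt (nxt (nxt e)) = e /\ nxt e != e.
Proof.
move=> et; have o := triv et; split.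
  by have := iter_order nxt_inj e; rewrite o.
apply/eqP => ne; have: order nxt e = size [:: e].
  by apply: order_cycle; rewrite /= ?ne ?inE ?eqxx.
by rewrite o.
Qed.

Lemma nxt_t e : (nxt e == t) = (e == t).
Proof. by rewrite -{1}nxt_tail inj_eq. Qed.

Let xt : x != t. Proof. by case/and3P: flipx. Qed.
Let Xt : bar x != t. Proof. by case/and3P: flipx. Qed.
Let nb : nxt b = x. Proof. by case: (trivP xt). Qed.
Let nd : nxt d = bar x. Proof. by case: (trivP Xt). Qed.
Let fc e h : e != t -> fconnect nxt e h = (h \in [:: e; nxt e; nxt (nxt e)]).
Proof.
move=> et; have [n3 n1] := trivP et.
by rewrite fconnect_orbit; case: (order3 nxt_inj n3 n1) => _ ->.
Qed.

Let dart6 : uniq [:: x; a; b; bar x; c; d].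
Proof.
have [_ _ xX] := and3P flipx.
have ux : uniq [:: x; a; b].
  by have [n3 n1] := trivP xt; case: (order3 nxt_inj n3 n1) => _ <-; apply: orbit_uniq.
have uX : uniq [:: bar x; c; d].
  by have [n3 n1] := trivP Xt; case: (order3 nxt_inj n3 n1) => _ <-; apply: orbit_uniq.
rewrite -[[:: x; a; b; bar x; c; d]]/([:: x; a; b] ++ [:: bar x; c; d]).
rewrite cat_uniq ux uX andbT; apply/hasPn => h Xh; apply: contra xX => xh.
apply: (@connect_trans _ _ h); first by rewrite fc.
by rewrite fconnect_sym // fc.
Qed.

Let dartE i j : i < 6 -> j < 6 ->
  (nth x [:: x; a; b; bar x; c; d] i == nth x [:: x; a; b; bar x; c; d] j) = (i == j).
Proof. by move=> i6 j6; rewrite nth_uniq. Qed.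

Let fd : flip_nxt d = a. Proof. by rewrite /flip_nxt eqxx. Qed.
Let fa : flip_nxt a = bar x.
Proof. by rewrite /flip_nxt (dartE (i:=1) (j:=5)) // eqxx. Qed.
Let fX : flip_nxt (bar x) = d.
Proof.
by rewrite /flip_nxt (dartE (i:=3) (j:=5)) // (dartE (i:=3) (j:=1)) // eqxx.
Qed.
Let fb : flip_nxt b = c.
Proof.
by rewrite /flip_nxt (dartE (i:=2) (j:=5)) // (dartE (i:=2) (j:=1)) //
   (dartE (i:=2) (j:=3)) // eqxx.
Qed.
Let fcx : flip_nxt c = x.
Proof.
by rewrite /flip_nxt (dartE (i:=4) (j:=5)) // (dartE (i:=4) (j:=1)) //
  (dartE (i:=4) (j:=3)) // (dartE (i:=4) (j:=2)) // eqxx.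
Qed.
Let fx : flip_nxt x = b.
Proof.
by rewrite /flip_nxt (dartE (i:=0) (j:=5)) // (dartE (i:=0) (j:=1)) //
  (dartE (i:=0) (j:=3)) // (dartE (i:=0) (j:=2)) // (dartE (i:=0) (j:=4)) // eqxx.
Qed.

Let star := [:: x; a; b; bar x; c; d].

Let fo h : h \notin star -> flip_nxt h = nxt h.
Proof.
rewrite !inE !negb_or => /and3P[/negbTE hx /negbTE ha /and4P[/negbTE hb /negbTE hX /negbTE hc /negbTE hd]].
by rewrite /flip_nxt hx ha hb hX hc hd.
Qed.

Let star_nxt h : (nxt h \in star) = (h \in star).
Proof.
rewrite !inE -{1}nb -[nxt h == bar x]/(nxt h == bar x) -{1}nd !(inj_eq nxt_inj).
by rewrite (orbC (h == b)) -!orbA; do !bool_congr; rewrite orbC -!orbA; do !bool_congr.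
Qed.

Let star_t h : h \in star -> h != t.
Proof.
have at_ : a != t by rewrite nxt_t.
have ct : c != t by rewrite nxt_t.
by rewrite !inE => /or4P[/eqP->|/eqP->|/eqP->|/or3P[] /eqP->] //; rewrite nxt_t.
Qed.

Lemma flip_nxt_tail : flip_nxt t = t.
Proof. by rewrite fo // ; apply/negP => /star_t; rewrite eqxx. Qed.

Lemma flip_nxt3 h : h != t ->
  flip_nxt (flip_nxt (flip_nxt h)) = h /\ flip_nxt h != h.
Proof.
move=> ht; case: (boolP (h \in star)) => [|hs].
  rewrite !inE => /or4P[/eqP->|/eqP->|/eqP->|/or3P[] /eqP->];
   rewrite !(fx, fa, fb, fX, fcx, fd); split=> //.
  - by rewrite (dartE (i:=2) (j:=0)).
  - by rewrite (dartE (i:=3) (j:=1)).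
  - by rewrite (dartE (i:=4) (j:=2)).
  - by rewrite (dartE (i:=5) (j:=3)).
  - by rewrite (dartE (i:=0) (j:=4)).
  - by rewrite (dartE (i:=1) (j:=5)).
by rewrite (fo hs) !fo ?star_nxt //; exact: trivP.
Qed.

Lemma flip_nxt_inj : injective flip_nxt.
Proof.
apply: (can_inj (g := fun h => flip_nxt (flip_nxt h))) => h.
by have [->|/flip_nxt3[]//] := eqVneq h t; rewrite !flip_nxt_tail.
Qed.

Lemma flip_order h : h != t -> order flip_nxt h = 3 /\
  orbit flip_nxt h = [:: h; flip_nxt h; flip_nxt (flip_nxt h)].
Proof. by move=> /flip_nxt3[n3 n1]; apply: order3 flip_nxt_inj n3 n1. Qed.

Let fcF e h : e != t ->
  fconnect flip_nxt e h = (h \in [:: e; flip_nxt e; flip_nxt (flip_nxt e)]).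
Proof. by move=> /flip_order[_ <-]; rewrite fconnect_orbit. Qed.

Lemma flip_nxt_boundary : (forall e f, fconnect (bar \o nxt) e f) ->
  forall e f, fconnect (bar \o flip_nxt) e f.
Proof.
move=> conn.
pose C := fconnect (bar \o flip_nxt) t.
have CS h : C h -> C (bar (flip_nxt h)).
  by move=> Ch; apply: connect_trans Ch _; apply: (fconnect1 (bar \o flip_nxt)).
pose P h := if h == x then C d else if h == bar x then C b else C h.
have Pout h : h != x -> h != bar x -> C h -> P h.
  by move=> /negbTE hx /negbTE hX; rewrite /P hx hX.
have barE u v : (bar u == bar v) = (u == v) by rewrite (inj_eq (can_inj barK)).
have barX u : (bar u == x) = (u == bar x) by rewrite -{1}(barK x) barE.
have PS h : P h -> P (bar (nxt h)).
  case: (boolP (h \in star)) => [|hs].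
    rewrite !inE => /or4P[/eqP->|/eqP->|/eqP->|/or3P[] /eqP->].
    - rewrite {1}/P eqxx => /CS; rewrite fd; apply: Pout; rewrite ?barE ?barX.
        by rewrite (dartE (i:=1) (j:=3)).
      by rewrite (dartE (i:=1) (j:=0)).
    - rewrite {1}/P (dartE (i:=1) (j:=0)) // (dartE (i:=1) (j:=3)) //.
      move=> /CS; rewrite fa barK => /CS; rewrite fx; apply: Pout; rewrite ?barE ?barX.
        by rewrite (dartE (i:=2) (j:=3)).
      by rewrite (dartE (i:=2) (j:=0)).
    - rewrite {1}/P (dartE (i:=2) (j:=0)) // (dartE (i:=2) (j:=3)) // nb.
      by rewrite /P barX (dartE (i:=0) (j:=3)) // eqxx.
    - rewrite {1}/P eqxx (dartE (i:=3) (j:=0)) // => /CS; rewrite fb.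
      apply: Pout; rewrite ?barE ?barX.
        by rewrite (dartE (i:=4) (j:=3)).
      by rewrite (dartE (i:=4) (j:=0)).
    - rewrite {1}/P (dartE (i:=4) (j:=0)) // (dartE (i:=4) (j:=3)) //.
      move=> /CS; rewrite fcx => /CS; rewrite fX; apply: Pout; rewrite ?barE ?barX.
        by rewrite (dartE (i:=5) (j:=3)).
      by rewrite (dartE (i:=5) (j:=0)).
    - rewrite {1}/P (dartE (i:=5) (j:=0)) // (dartE (i:=5) (j:=3)) // nd barK.
      by rewrite /P eqxx.
  have := hs; rewrite !inE !negb_or => /and3P[hx ha /and4P[hb hX hc hd]].
  rewrite {1}/P (negbTE hx) (negbTE hX) => /CS; rewrite fo //.
  by apply: Pout; [rewrite barX -nd | rewrite barE -nb]; rewrite inj_eq.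
have PA h : P h.
  have /connectP[q] := conn t h; elim/last_ind: q h => [|q u IH] h /=.
    by move=> _ ->; apply: Pout; rewrite 1?eq_sym //; apply: connect0.
  rewrite rcons_path last_rcons => /andP[pq /eqP uE] ->.
  by rewrite -uE; apply/PS/IH.
have Ca : C a.
  by have := PA a; rewrite /P (dartE (i:=1) (j:=0)) // (dartE (i:=1) (j:=3)).
have Cc : C c.
  by have := PA c; rewrite /P (dartE (i:=4) (j:=0)) // (dartE (i:=4) (j:=3)).
have CA h : C h.
  have := PA h; rewrite /P; case: eqP => [->|_].
    by move=> _; have := CS _ Ca; rewrite fa barK.
  by case: eqP => [->|//]; move=> _; have := CS _ Cc; rewrite fcx.
have cI : injective (bar \o flip_nxt).
  exact: inj_comp (can_inj barK) flip_nxt_inj.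
by move=> e f; apply: connect_trans (CA f); rewrite fconnect_sym //; apply: CA.
Qed.

Lemma flip_fcard : fcard flip_nxt D = fcard nxt D.
Proof.
have H (f : D -> D) : injective f -> f t = t ->
    (forall e, e != t -> order f e = 3) -> fcard f D * 3 = #|D| + 2.
  move=> fI ft f3; rewrite (n_compC (pred1 t)) mulnDl.
  have cl : fclosed f (pred1 t).
    by move=> u v /eqP <-; rewrite !inE -{2}ft inj_eq.
  have ot : order f t = 1.
    by apply: (@order_cycle _ f [:: t]); rewrite /= ?ft ?inE ?eqxx.
  have := @fcard_order_set _ f fI 1 (pred1 t); rewrite muln1 card1 => -> //; last first.
    by apply/fintype.subsetP => u /eqP ->; rewrite !inE ot.
  rewrite (fcard_order_set fI); first last.
  - by move=> u v uv; congr (~~ _); apply: cl.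
  - by apply/fintype.subsetP => u; rewrite !inE => /f3 ->.
  by rewrite -(cardC (pred1 t)) card1 addnAC.
apply/eqP; rewrite -(@eqn_pmul2r 3) //.
rewrite (H _ flip_nxt_inj flip_nxt_tail) ?(H _ nxt_inj nxt_tail) //.
by move=> e /flip_order[].
Qed.

Section Mark.
Variables (pi : groupType) (mu : D -> pi).
Local Open Scope group_scope.
Hypothesis mu_bar : forall e, mu (bar e) = (mu e)^-1.
Hypothesis mu_vertex : forall e, e != t -> \prod_(h <- orbit nxt e) mu h = 1.
Hypothesis mu_gen : generates mu.
Let mu' := flip_mark mu.

Let mu3 e : e != t -> mu e * mu (nxt e) * mu (nxt (nxt e)) = 1.
Proof.
move=> et; have [n3 n1] := trivP et; have := mu_vertex et.
case: (order3 nxt_inj n3 n1) => _ ->.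
by rewrite !big_cons big_nil mulg1 mulgA.
Qed.

Let mx' : mu' x = mu d * mu a. Proof. by rewrite /mu' /flip_mark eqxx. Qed.
Let mX' : mu' (bar x) = (mu d * mu a)^-1.
Proof. by rewrite /mu' /flip_mark (dartE (i:=3) (j:=0)) // eqxx. Qed.
Let mo' h : h != x -> h != bar x -> mu' h = mu h.
Proof. by move=> /negbTE hx /negbTE hX; rewrite /mu' /flip_mark hx hX. Qed.
Let ma' : mu' a = mu a. Proof. by rewrite mo' // ?(dartE (i:=1) (j:=0)) ?(dartE (i:=1) (j:=3)). Qed.
Let mb' : mu' b = mu b. Proof. by rewrite mo' // ?(dartE (i:=2) (j:=0)) ?(dartE (i:=2) (j:=3)). Qed.
Let mc' : mu' c = mu c. Proof. by rewrite mo' // ?(dartE (i:=4) (j:=0)) ?(dartE (i:=4) (j:=3)). Qed.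
Let md' : mu' d = mu d. Proof. by rewrite mo' // ?(dartE (i:=5) (j:=0)) ?(dartE (i:=5) (j:=3)). Qed.

Lemma flip_mark_bar e : mu' (bar e) = (mu' e)^-1.
Proof.
have [->|ex] := eqVneq e x; first by rewrite mX' mx'.
have [->|eX] := eqVneq e (bar x); first by rewrite barK mx' mX' invgK.
rewrite mo' ?mu_bar ?mo' // (inv_eq barK) //.
by rewrite barK.
Qed.

Lemma rot1 (u v w : pi) : u * v * w = 1 -> v * w * u = 1.
Proof. by move=> E; apply: (mulgI u); rewrite !mulgA E mul1g mulg1. Qed.

Lemma flip_mark_vertex e : e != t -> \prod_(h <- orbit flip_nxt e) mu' h = 1.
Proof.
move=> et; case: (flip_order et) => _ ->; rewrite !big_cons big_nil mulg1 mulgA.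
have v1 : mu' d * mu' a * mu' (bar x) = 1 by rewrite md' ma' mX' mulgV.
have v2 : mu' b * mu' c * mu' x = 1.
  rewrite mb' mc' mx' !mulgA; apply/rot1; rewrite !mulgA.
  have := mu3 xt; rewrite -/a -/b => /rot1 abx.
  have := mu3 Xt; rewrite -/c -/d mu_bar => cd.
  have -> : mu a * mu b * mu c * mu d = mu a * mu b * mu x.
    rewrite -mulgA; congr (_ * _).
    by apply: (mulgI (mu x)^-1); rewrite mulgA cd mulVg.
  exact: abx.
case: (boolP (e \in star)) => [|es].
  rewrite !inE => /or4P[/eqP->|/eqP->|/eqP->|/or3P[] /eqP->];
    rewrite !(fx, fa, fb, fX, fcx, fd).
  - exact/rot1/rot1.
  - exact/rot1.
  - exact: v2.
  - exact/rot1/rot1.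
  - exact/rot1.
  - exact: v1.
have mos h : h \notin star -> mu' h = mu h.
  by rewrite !inE !negb_or => /and3P[? _ /and4P[_ ? _ _]]; rewrite mo'.
by rewrite !fo ?fo ?star_nxt // !mos ?star_nxt // mu3.
Qed.

Lemma flip_mark_generates : generates mu'.
Proof.
move=> S S1 SM SV Smu'; apply: mu_gen => // h.
have Sx : S (mu x).
  have := mu3 Xt; rewrite -/c -/d mu_bar => cd.
  have -> : mu x = mu' c * mu' d.
    by rewrite mc' md'; apply: (mulgI (mu x)^-1); rewrite mulgA cd mulVg.
  by apply: SM.
have [->//|hx] := eqVneq h x; have [->|hX] := eqVneq h (bar x).
  by rewrite mu_bar; apply: SV.
by rewrite -mo'.
Qed.

Lemma flip_mark_tail : mu' t = mu t.
Proof. by rewrite mo' // eq_sym. Qed.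

End Mark.

Let fconnect_t (f : D -> D) v : f t = t -> fconnect f t v = (v == t).
Proof.
by move=> ft; rewrite (@fconnect_cycle _ f [:: t]) ?inE //= ?ft ?eqxx.
Qed.

Let fconnect_far u v :
  u \notin star -> fconnect flip_nxt u v = fconnect nxt u v.
Proof.
move=> us; have [->|ut] := eqVneq u t.
  by rewrite !fconnect_t ?flip_nxt_tail.
by rewrite fcF // fc // !fo ?fo ?star_nxt.
Qed.

Let near_nxt v : fconnect nxt v x + fconnect nxt v (bar x) = (v \in star).
Proof.
rewrite ![fconnect nxt v _]fconnect_sym // !fc // -/a -/b -/c -/d.
rewrite -[star]/([:: x; a; b] ++ [:: bar x; c; d]) mem_cat.
have := dart6; rewrite -[[:: x, a & _]]/([:: x; a; b] ++ [:: bar x; c; d]).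
rewrite cat_uniq => /and3P[_ /hasPn H _].
by have := H v; case: (v \in [:: x; a; b]); case: (v \in _) => // /(_ isT).
Qed.

Let near_flip v :
  fconnect flip_nxt v x + fconnect flip_nxt v (bar x) = (v \in star).
Proof.
have fI := flip_nxt_inj.
rewrite ![fconnect flip_nxt v _]fconnect_sym // !fcF // fx fb fX fd.
have -> : (v \in star) = (v \in [:: x; b; c] ++ [:: bar x; d; a]).
  rewrite mem_cat !inE; do 6!case: (v == _) => //.
have : uniq ([:: x; b; c] ++ [:: bar x; d; a]).
  rewrite (@perm_uniq _ _ star) // /star.
  by apply/permP => P /=; rewrite !addn0; do 6!case: (P _).
rewrite cat_uniq mem_cat => /and3P[_ /hasPn H _].
by have := H v; case: (v \in [:: x; b; c]); case: (v \in _) => // /(_ isT).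
Qed.

Lemma flip_flippable : [&& x != t, bar x != t & ~~ fconnect flip_nxt x (bar x)].
Proof.
rewrite xt Xt /=; have := near_flip x; rewrite connect0 !inE eqxx.
by case: (connect _ _ _).
Qed.

Variable y : D.
Hypothesis flipy : [&& y != t, bar y != t & ~~ fconnect nxt y (bar y)].

Let sharedE : shared bar nxt x y = (y \in star) + (bar y \in star).
Proof.
rewrite /shared /= -!near_nxt !addn0.
have S u v : fconnect nxt u v = fconnect nxt v u by rewrite fconnect_sym.
by rewrite (S y x) (S y (bar x)) (S (bar y) x) (S (bar y)) addnA addnACA.
Qed.

Lemma flip_shared : shared bar flip_nxt y x = shared bar nxt x y.
Proof. by rewrite sharedE -!near_flip /shared /= !addn0 addnA. Qed.

Lemma flip_flippable_other : shared bar nxt x y <= 1 ->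
  [&& y != t, bar y != t & ~~ fconnect flip_nxt y (bar y)].
Proof.
case/and3P: flipy => -> -> yY /=; rewrite sharedE.
case: (boolP (y \in star)) => ys; case: (boolP (bar y \in star)) => Ys //= _.
- by rewrite fconnect_sym ?fconnect_far 1?fconnect_sym //; apply: flip_nxt_inj.
- by rewrite fconnect_far.
- by rewrite fconnect_far.
Qed.

End FlipFunctions.

(* The vertices of the dual fatgraph complex, before identifying isomorphic
   ones. *)
Record tspine (g : nat) : Type := TSpine {
  tspine_spine :> spine g;
  tspine_trivalent : trivalent tspine_spine }.

Definition flip_edge (G : fatgraph) (x : dart G) : bool :=
  flippable bar nxt tail x.

Section Flip.
Variables (g : nat) (G : tspine g) (x : dart G) (fx : flip_edge x).

Let bK := @barK G.
Let nI := @nxt_inj G.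
Let nt := @nxt_tail G.
Let tri := @tspine_trivalent g G.

Let nxt' := flip_nxt bar nxt x.

Let flip_boundary : forall e f : dart G, fconnect (bar \o nxt') e f.
Proof. exact: (flip_nxt_boundary bK nI nt tri fx (@spine_boundary _ G)). Qed.

Let flip_valence e : e != tail -> 3 <= order nxt' e.
Proof. by move=> et; case: (flip_order nI nt tri fx et) => ->. Qed.

Let flip_connected (e f : dart G) :
  connect [rel x y | (y == bar x) || (y == nxt' x)] e f.
Proof.
apply: connect_sub (flip_boundary e f) => u v /eqP <- /=.
by apply: (@connect_trans _ _ (nxt' u)); apply: connect1; rewrite /= eqxx ?orbT.
Qed.

Definition flip_graph : fatgraph := Fatgraph bK (@bar_neq G)
  (flip_nxt_inj nI nt tri fx) (flip_nxt_tail nI nt fx)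
  flip_valence flip_connected.

Let flip_genus : has_genus g flip_graph.
Proof.
by rewrite /has_genus /= (flip_fcard nI nt tri fx); exact: (spine_genus G).
Qed.

Definition flip_spine : spine g :=
  @Spine g flip_graph flip_boundary flip_genus (flip_mark bar nxt x (@mark g G))
    (flip_mark_bar bK nI tri fx (@mark_bar g G))
    (@flip_mark_vertex _ _ _ _ _ nI nt tri fx _ _ (@mark_bar g G) (@mark_vertex g G))
    (flip_mark_generates nI tri fx (@mark_bar g G) (@mark_vertex g G)
       (@mark_generates g G))
    (etrans (flip_mark_tail fx _) (@mark_tail g G)).

(* The spine obtained from [G] by the flip along the edge of [x]. *)
Definition flip_target : tspine g :=
  @TSpine g flip_spine (fun e et => proj1 (flip_order nI nt tri fx et)).

Lemma flip_edge_target : @flip_edge flip_target x.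
Proof. exact: (flip_flippable nI nt tri fx). Qed.

End Flip.

(* A flip together with a choice between its two labellings. *)
Record flip (g : nat) : Type := Flip {
  flip_src : tspine g;
  flip_dart : dart flip_src;
  flip_ok : flip_edge flip_dart }.

Definition flip_tgt g (W : flip g) : tspine g := flip_target (flip_ok W).
Definition flip_inv g (W : flip g) : flip g := Flip (flip_edge_target (flip_ok W)).

Definition half_a g (W : flip g) := nxt (flip_dart W).
Definition half_b g (W : flip g) := nxt (half_a W).
Definition half_c g (W : flip g) := nxt (bar (flip_dart W)).
Definition half_d g (W : flip g) := nxt (half_c W).

(* Two flips along edges that share at most one endpoint. *)
Record flip_pair (g : nat) : Type := FlipPair {
  pair_src : tspine g;
  pair_fst : dart pair_src;
  pair_snd : dart pair_src;
  pair_fst_ok : flip_edge pair_fst;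
  pair_snd_ok : flip_edge pair_snd;
  pair_shared : shared bar nxt pair_fst pair_snd <= 1 }.

Section PairStep.
Variables (g : nat) (P : flip_pair g).

Lemma pair_step_ok : @flip_edge (flip_target (pair_fst_ok P)) (pair_snd P).
Proof.
exact: (flip_flippable_other (@nxt_inj _) (@nxt_tail _)
  (@tspine_trivalent g (pair_src P)) (pair_fst_ok P) (pair_snd_ok P) (pair_shared P)).
Qed.

Lemma pair_step_shared :
  shared (@bar (flip_target (pair_fst_ok P))) nxt (pair_snd P) (pair_fst P) <= 1.
Proof.
have := pair_shared P; rewrite /=.
by rewrite (flip_shared (@nxt_inj _) (@nxt_tail _)
  (@tspine_trivalent g (pair_src P)) (pair_fst_ok P)).
Qed.

Definition pair_step : flip_pair g :=
  @FlipPair g (flip_target (pair_fst_ok P)) (pair_snd P) (pair_fst P)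
    pair_step_ok (flip_edge_target (pair_fst_ok P)) pair_step_shared.

Definition pair_flip : flip g := Flip (pair_fst_ok P).

End PairStep.

(* Flipping alternately the two edges closes up after four flips if they are
   disjoint (commutativity), and after five flips if they share an endpoint
   (pentagon). *)
Definition pair_loop g (P : flip_pair g) : seq (flip g) :=
  map (@pair_flip g) (traject (@pair_step g) P
    (if shared bar nxt (pair_fst P) (pair_snd P) == 0 then 4 else 5)).

(** * The action of the mapping class group *)

Section Action.
Variables (g : nat) (phi : mapping_class g).

Section ActSpine.
Variable G : spine g.
Let mark' (e : dart G) := phi (mark e).

Let act_bar e : mark' (bar e) = ((mark' e)^-1)%g.
Proof. by rewrite /mark' mark_bar mcV. Qed.

Let act_vertex_rel e : e != tail -> (\prod_(h <- orbit nxt e) mark' h)%g = 1%g.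
Proof.
move=> et; rewrite -[RHS](mc1 phi) -[in RHS](mark_vertex et).
by rewrite (big_morph phi (@mc_mul g phi) (mc1 phi)).
Qed.

Let act_generates : generates mark'.
Proof.
move=> S S1 SM SV Sm x; have [psi _ pK] := mc_bij phi; rewrite -(pK x).
move: (psi x); apply: (@mark_generates g G (fun y => S (phi y))) => //=.
- by rewrite mc1.
- by move=> y z Sy Sz; rewrite mc_mul; apply: SM.
- by move=> y Sy; rewrite mcV; apply: SV.
Qed.

Definition act_spine : spine g :=
  @Spine g G (@spine_boundary g G) (@spine_genus g G) mark' act_bar
    act_vertex_rel act_generates
    (etrans (congr1 phi (@mark_tail g G)) (mc_zeta phi)).

End ActSpine.

Definition act_tspine (G : tspine g) : tspine g :=
  @TSpine g (act_spine G) (@tspine_trivalent g G).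

Definition act_flip (W : flip g) : flip g :=
  @Flip g (act_tspine (flip_src W)) (flip_dart W) (flip_ok W).

End Action.

(** * The dual fatgraph complex *)

Section Classes.
Variables (T : Type) (R : T -> T -> Prop).

(* The set of equivalence classes of [R]. *)
Definition classes : Type := {C : set T | exists x, C = R x}.

Definition class_of (x : T) : classes := exist _ (R x) (ex_intro _ x erefl).

Definition class_repr (C : classes) : T := projT1 (cid (proj2_sig C)).

End Classes.

(* The part of a 2-dimensional cell complex relevant to 1-cocycles: vertices,
   oriented edges, and boundary loops of the 2-cells, for all base points and
   orientations. *)
Record cell_complex : Type := CellComplex {
  vertex : Type;
  edge : Type;
  edge_src : edge -> vertex;
  edge_tgt : edge -> vertex;
  edge_inv : edge -> edge;
  boundary_loop : set (seq edge) }.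

Definition cocycle (X : cell_complex) (A : zmodType) (c : edge X -> A) : Prop :=
  (forall e, c (edge_inv e) = - c e)%R /\
  (forall w, boundary_loop w -> (\sum_(e <- w) c e)%R = 0%R).

Definition quotient_complex (X : cell_complex) (Rv : vertex X -> vertex X -> Prop)
    (Re : edge X -> edge X -> Prop) : cell_complex := {|
  vertex := classes Rv;
  edge := classes Re;
  edge_src := fun C => class_of Rv (edge_src (class_repr C));
  edge_tgt := fun C => class_of Rv (edge_tgt (class_repr C));
  edge_inv := fun C => class_of Re (edge_inv (class_repr C));
  boundary_loop := [set map (class_of Re) w | w in @boundary_loop X]%classic |}.

Definition spine_eq g (G H : tspine g) : Prop := inhabited (spine_iso G H).

Definition flip_eq g (V W : flip g) : Prop :=
  exists f : spine_iso (flip_src V) (flip_src W),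
    f (flip_dart V) = flip_dart W \/ f (flip_dart V) = bar (flip_dart W).

Definition flip_class g : flip g -> classes (@flip_eq g) := class_of (@flip_eq g).

(* The 2-cells correspond to the pairs of edges sharing at most one endpoint:
   contracting them gives a spine that is trivalent except for two 4-valent
   vertices, or one 5-valent vertex. *)
Definition dual_complex (g : nat) : cell_complex := {|
  vertex := classes (@spine_eq g);
  edge := classes (@flip_eq g);
  edge_src := fun C => class_of (@spine_eq g) (flip_src (class_repr C));
  edge_tgt := fun C => class_of (@spine_eq g) (flip_tgt (class_repr C));
  edge_inv := fun C => flip_class (flip_inv (class_repr C));
  boundary_loop := [set w | exists P, w = map (@flip_class g) (pair_loop P)]%classic |}.

Definition act_vertex g (phi : mapping_class g) (v : vertex (dual_complex g)) :
  vertex (dual_complex g) := class_of (@spine_eq g) (act_tspine phi (class_repr v)).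

Definition act_edge g (phi : mapping_class g) (e : edge (dual_complex g)) :
  edge (dual_complex g) := flip_class (act_flip phi (class_repr e)).

(** * Markings and cochains *)

Section Marking.
Local Open Scope ring_scope.
Variables (g : nat) (K : zmodType) (p : surface_group g -> K).

Definition is_marking : Prop :=
  {morph p : x y / (x * y)%g >-> x + y} /\ (forall k, exists x, p x = k).

Definition MC_nabla (phi : mapping_class g) : Prop := p \o phi = p.

Definition MC_box (phi : mapping_class g) : Prop :=
  (phi @` [set x | p x = 0] = [set x | p x = 0])%classic.

Definition nabla_complex : cell_complex := quotient_complex
  (fun v w : vertex (dual_complex g) => exists2 phi, MC_nabla phi & act_vertex phi v = w)
  (fun e f : edge (dual_complex g) => exists2 phi, MC_nabla phi & act_edge phi e = f).

Definition nabla_proj : edge (dual_complex g) -> edge nabla_complex := class_of _.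

(* [F t] is the action on [A] of an automorphism [t] of [K]. *)
Definition box_equivariant (A : zmodType) (F : {additive K -> K} -> A -> A)
    (c : edge (dual_complex g) -> A) : Prop :=
  forall phi, MC_box phi -> exists t : {additive K -> K},
    [/\ bijective t, p \o phi = t \o p & forall e, c (act_edge phi e) = F t (c e)].

Definition descends (A : zmodType) (c : edge (dual_complex g) -> A) : Prop :=
  exists c' : edge nabla_complex -> A, cocycle c' /\ c' \o nabla_proj = c.

Definition dart_value (G : spine g) (e : dart G) : K := p (mark e).

Definition m_value (W : flip g) : K := dart_value (half_a W) + dart_value (half_c W).

Definition j_value (W : flip g) : ext 3 K :=
  wedge3 (dart_value (half_a W)) (dart_value (half_b W)) (dart_value (half_c W)).

Definition s_value (W : flip g) : sym_tensor (ext 2 K) :=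
  sym_prod (wedge2 (dart_value (half_a W)) (dart_value (half_c W)))
           (wedge2 (dart_value (half_b W)) (dart_value (half_d W))).

End Marking.

(* Main.v *)
From HB Require Import structures.
Require Import Defs.
From mathcomp Require Import all_boot all_order all_algebra.
From mathcomp Require Import boolp classical_sets.

Set Implicit Arguments.
Unset Strict Implicit.
Unset Printing Implicit Defensive.

Import GRing.Theory.
Local Open Scope ring_scope.

(** The three cochains have one shape: with [a], [b], [c], [d] the labels in [K]
of the half-edges around the flipped edge, in cyclic order, the flip is sent to
[F a b c d] for a natural function [F] on quadruples of sum zero.  Everything
comes down to two identities for [F].

- A quarter turn changes the sign: [F b c d a = - F a b c d].  Applied twice, it
  makes the value independent of the choice between the two labellings of a flip;
  applied once, it gives the sign change under reversal, because the reverse flip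
  has [b], [c], [d], [a] around its edge.  It also settles the commutation
  squares: flipping twice along disjoint edges [x] and [y] alternately, each flip
  meets the same four labels as two steps before, turned by a quarter.

- A five-term relation for labels [u1], ..., [u5] of sum zero, the labels of the
  half-edges around a 5-valent vertex.  Expand that vertex into two edges [x] and
  [y].  A flip of [x] leaves these five half-edges in place, and the result is an
  expansion of the same kind with [x] and [y] exchanged and the five labels turned
  by two fifths.  The five flips of a pentagon hence take the values
  [F (u3 + u4) u5 u1 u2] and its cyclic shifts; the other sense of traversal gives
  the opposites of these in the opposite order.

For [m] and [j] the relation uses that the labels add up to zero; for [s] its ten
terms, after expansion, cancel in pairs by skew-symmetry of the wedge and symmetry
of the product.

Equivariance is naturality of [F]: an element of the larger group acts on [K] by
an automorphism [t] with [p \o phi = t \o p], so it changes the labels by [t].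
For elements of the smaller group [t] is the identity, the cochain is invariant,
and therefore it descends.

The combinatorial part is carried by [square_flip], [pentagon_flip_fst] and
[pentagon_flip_snd], the summation over boundary loops by [pair_loop_sum0], and
the two identities by the lemmas on [m_form], [j_form] and [s_form]. *)

(** * Flips of labelled trivalent graphs *)

Ltac split_neq := rewrite /= !inE !negb_or -!andbA;
  repeat (let H := fresh "ne" in case/andP => H).
Ltac by_neq := repeat match goal with
  | |- context [?u == ?u] => rewrite eqxx
  | H : is_true (?u != ?w) |- context [?u == ?w] => rewrite (negbTE H)
  | H : is_true (?u != ?w) |- context [?w == ?u] => rewrite [w == u]eq_sym (negbTE H)
  end.

Ltac uniq_of U := move: (U); split_neq => _; by_neq; by [].

Section Identities.
Variables (K A : zmodType) (F : K -> K -> K -> K -> A).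

Definition quarter_turn_skew : Prop := forall a b c d,
  a + b + c + d = 0 -> F b c d a = - F a b c d.

(** The labels [a], ..., [e] sit around a 5-valent vertex; each term is the value
of one of the flips of the pentagon, whose quadrilateral has one diagonal of the
pentagon, labelled by the sum of two adjacent labels, as a side. *)
Definition pentagon_relation : Prop := forall a b c d e,
  a + b + c + d + e = 0 ->
  F (a + b) c d e + F (c + d) e a b + F (e + a) b c d + F (b + c) d e a
    + F (d + e) a b c = 0.

End Identities.

Section LocalFlips.
Variables (D : finType) (K : zmodType) (bar : D -> D).
Hypothesis barK : involutive bar.

Definition same_edge (x y : D) : Prop := x = y \/ x = bar y.

(** What [flip_mark] becomes when the marking is pushed to an abelian group. *)
Definition flip_label (n : D -> D) (x : D) (v : D -> K) (h : D) : K :=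
  if h == x then v (n (n (bar x))) + v (n x) else
  if h == bar x then - (v (n (n (bar x))) + v (n x)) else v h.

Definition tripod (n : D -> D) (v : D -> K) (a b c : D) : Prop :=
  [/\ n a = b, n b = c, n c = a & v a + v b + v c = 0].

Lemma tripod_rot n v a b c : tripod n v a b c -> tripod n v b c a.
Proof. by case=> ? ? ? s; split=> //; rewrite addrC addrA. Qed.

(** The situation before a flip: the half-edges [a], [b], [c], [d] in
counterclockwise order around the edge of [x]. *)
Definition square n v x a b c d : Prop :=
  [/\ uniq [:: x; bar x; a; b; c; d],
      tripod n v x a b, tripod n v (bar x) c d & v (bar x) = - v x].

Lemma square_label n v x a b c d : square n v x a b c d ->
  v a + v b = - v x /\ v c + v d = v x.
Proof.
case=> _ [_ _ _ s1] [_ _ _ s2] vX.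
split; apply/eqP; first by rewrite -addr_eq0 addrC addrA s1.
by rewrite -[v x]opprK -vX -addr_eq0 addrC addrA s2.
Qed.

Lemma square_sum n v x a b c d : square n v x a b c d ->
  v a + v b + v c + v d = 0.
Proof. by case/square_label => ab cd; rewrite -addrA ab cd addNr. Qed.

(** A flip turns the four half-edges around its edge by a quarter.  The name [x'] of
the flipped half-edge is only fixed up to reversal: the two names correspond to the
labellings [(a, b, c, d)] and [(c, d, a, b)] and give the same graph and labels,
since [v d + v a = - (v b + v c)]. *)
Lemma square_flip n v x a b c d x' :
  square n v x a b c d -> same_edge x' x ->
  square (flip_nxt bar n x') (flip_label n x' v) x b c d a.
Proof.
move=> sq; have sum0 := square_sum sq.
case: sq => U [xa ab bx s1] [Xc cd dX s2] vX x'E.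
have daE : v d + v a = - (v b + v c).
  by apply/eqP; rewrite -addr_eq0 -sum0; apply/eqP; rewrite (AC (2*2) ((2*3)*4*1)).
have bcE : v b + v c = - (v d + v a) by rewrite daE opprK.
move: (U); split_neq => _.
split.
- rewrite (@perm_uniq _ _ [:: x; bar x; a; b; c; d]) //.
  by apply/permP => P /=; rewrite !addn0; do 6!case: (P _).
all: rewrite /tripod /flip_nxt /flip_label.
all: case: x'E => ->; rewrite ?barK !(xa, ab, bx, Xc, cd, dX).
all: do ?split; by_neq => //.
all: rewrite ?opprK //.
all: rewrite -?addrA ?addNr // !addrA -sum0.
  by rewrite (AC 4 (2*3*4*1)).
by rewrite (AC 4 (4*1*2*3)).
Qed.

Lemma flip_tripod_far n v x a b c d x' u1 u2 u3 :
  square n v x a b c d -> same_edge x' x ->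
  uniq ([:: x; bar x; a; b; c; d] ++ [:: u1; u2; u3]) ->
  tripod n v u1 u2 u3 -> tripod (flip_nxt bar n x') (flip_label n x' v) u1 u2 u3.
Proof.
move=> [_ [xa ab bx _] [Xc cd dX _] _] x'E; split_neq => _ [u12 u23 u31 s].
by rewrite /tripod /flip_nxt /flip_label; case: x'E => ->;
  rewrite ?barK !(xa, ab, bx, Xc, cd, dX); do ?split; by_neq.
Qed.

Lemma flip_label_far n v x x' h : same_edge x' x ->
  h != x -> h != bar x -> flip_label n x' v h = v h.
Proof.
by move=> x'E hx hX; rewrite /flip_label; case: x'E => ->; rewrite ?barK; by_neq.
Qed.

(** Edges [x] and [y] that share one endpoint, where [y] follows [x].  Contracting
both gives a 5-valent vertex with half-edges [c], [d], [e], [f], [z] in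
counterclockwise order. *)
Definition pentagon_at n v x y c d e f z : Prop :=
  [/\ uniq [:: x; bar x; y; bar y; c; d; e; f; z],
      [/\ tripod n v x y z, tripod n v (bar x) c d & tripod n v (bar y) e f]
    & v (bar x) = - v x /\ v (bar y) = - v y].

Definition squares_at n v x a b c d y e f g h : Prop :=
  uniq ([:: x; bar x; a; b; c; d] ++ [:: y; bar y; e; f; g; h]) /\
  square n v x a b c d /\ square n v y e f g h.

Lemma pentagon_squares n v x y c d e f z : pentagon_at n v x y c d e f z ->
  square n v x y z c d /\ square n v y z x e f.
Proof.
case=> U [t1 t2 t3] [vX vY].
by split; split=> //; [uniq_of U | uniq_of U | exact: tripod_rot].
Qed.

(** The square around [x] is [y], [z], [c], [d]; after the flip [bar x] follows [y],
so the configuration reappears with the edges exchanged and the five half-edges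
turned by two steps. *)
Lemma pentagon_flip_fst n v x y c d e f z x' :
  pentagon_at n v x y c d e f z -> same_edge x' x ->
  pentagon_at (flip_nxt bar n x') (flip_label n x' v) y (bar x) e f z c d.
Proof.
move=> pent x'E; have [sq _] := pentagon_squares pent.
case: pent => U [t1 t2 t3] [vX vY].
have U' : uniq ([:: x; bar x; y; z; c; d] ++ [:: bar y; e; f]).
  by uniq_of U.
have [_ t1' t2' vX'] := square_flip sq x'E.
have t3' := flip_tripod_far sq x'E U' t3.
move: (U); split_neq => _.
split; rewrite ?barK.
- by uniq_of U.
- by split=> //; apply/tripod_rot/tripod_rot.
- split; last by rewrite vX' opprK.
  by rewrite !(flip_label_far _ _ x'E); by_neq.
Qed.

(** Flipping the second edge instead traverses the pentagon in the opposite sense: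
the half-edges turn by two steps the other way. *)
Lemma pentagon_flip_snd n v x y c d e f z y' :
  pentagon_at n v x y c d e f z -> same_edge y' y ->
  pentagon_at (flip_nxt bar n y') (flip_label n y' v) y x f z c d e.
Proof.
move=> pent y'E; have [_ sq] := pentagon_squares pent.
case: pent => U [t1 t2 t3] [vX vY].
have U' : uniq ([:: y; bar y; z; x; e; f] ++ [:: bar x; c; d]).
  by uniq_of U.
have [_ t1' t3' vY'] := square_flip sq y'E.
have t2' := flip_tripod_far sq y'E U' t2.
move: (U); split_neq => _.
split=> //.
- by uniq_of U.
- by split=> //; rewrite !(flip_label_far _ _ y'E) ?vX; by_neq.
Qed.

Lemma squares_flip n v x a b c d y e f g h x' :
  squares_at n v x a b c d y e f g h -> same_edge x' x ->
  squares_at (flip_nxt bar n x') (flip_label n x' v) y e f g h x b c d a.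
Proof.
case=> U [sx [sy t1 t2 vY]] x'E.
have U1 : uniq ([:: x; bar x; a; b; c; d] ++ [:: y; e; f]).
  by uniq_of U.
have U2 : uniq ([:: x; bar x; a; b; c; d] ++ [:: bar y; g; h]).
  by uniq_of U.
split; first by uniq_of U.
split; last exact: square_flip sx x'E.
split; [by case: sy| exact: flip_tripod_far sx x'E U1 _ |
  exact: flip_tripod_far sx x'E U2 _|].
by move: U; split_neq; rewrite !(flip_label_far _ _ x'E); by_neq.
Qed.

Section Cochain.
Variables (A : zmodType) (F : K -> K -> K -> K -> A).
Hypothesis F_rot : quarter_turn_skew F.
Hypothesis F_pent : pentagon_relation F.

Definition flip_value (n : D -> D) (v : D -> K) (x : D) : A :=
  F (v (n x)) (v (n (n x))) (v (n (bar x))) (v (n (n (bar x)))).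

(** Two quarter turns cancel, so the value of a flip does not depend on which of
the two orientations names its edge. *)
Lemma flip_value_square n v x a b c d x' : square n v x a b c d ->
  same_edge x' x -> flip_value n v x' = F (v a) (v b) (v c) (v d).
Proof.
move=> sq; have s := square_sum sq; case: sq => _ [xa ab _ _] [Xc cd _ _] _.
case=> ->; rewrite /flip_value ?barK xa ab Xc cd //.
rewrite -[RHS]opprK -(F_rot s) -F_rot //.
by rewrite -s (AC 4 (4*1*2*3)).
Qed.

(** The sum of the values of [k] successive flips, along the edges of [x] and [y]
in turn. *)
Fixpoint alternate_sum (k : nat) (n : D -> D) (v : D -> K) (x y : D) : A :=
  if k is k'.+1 then
    flip_value n v x + alternate_sum k' (flip_nxt bar n x) (flip_label n x v) y x
  else 0.

(** The labels [u] and [w] around the two edges are recorded because they determine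
the values of all further flips. *)
Definition disjoint_squares n v x0 y0 (u : K * K * K * K) (w : K * K * K * K) :=
  exists x y a b c d e f g h,
  [/\ squares_at n v x a b c d y e f g h,
      u = (v a, v b, v c, v d), w = (v e, v f, v g, v h),
      same_edge x0 x & same_edge y0 y].

Lemma disjoint_squares_step n v x y u1 u2 u3 u4 w :
  disjoint_squares n v x y (u1, u2, u3, u4) w ->
  [/\ u1 + u2 + u3 + u4 = 0, flip_value n v x = F u1 u2 u3 u4
    & disjoint_squares (flip_nxt bar n x) (flip_label n x v) y x w (u2, u3, u4, u1)].
Proof.
case=> x1 [y1 [a [b [c [d [e [f [g [h [sq uE wE xE yE]]]]]]]]]].
case: uE => -> -> -> ->; have [U [sqx sqy]] := sq.
split; [exact: square_sum sqx | exact: flip_value_square sqx xE|].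
exists y1, x1, e, f, g, h, b, c, d, a; split=> //; first exact: squares_flip.
- by rewrite wE; move: U; split_neq => _; rewrite !(flip_label_far _ _ xE); by_neq.
- by move: U; split_neq => _; rewrite !(flip_label_far _ _ xE); by_neq.
Qed.

Lemma disjoint_squares_alternate_sum n v x y u w :
  disjoint_squares n v x y u w -> alternate_sum 4 n v x y = 0.
Proof.
case: u w => [[[u1 u2] u3] u4] [[[w1 w2] w3] w4].
case/disjoint_squares_step=> su /= -> /disjoint_squares_step[sw ->].
case/disjoint_squares_step=> _ -> /disjoint_squares_step[_ -> _].
by rewrite (F_rot su) (F_rot sw) addr0 -opprD addrA subrr.
Qed.

(** The edge to be flipped next is the first of the two edges of [pentagon_at] here,
and the second one in [pentagon_cw]; [u1], ..., [u5] are the labels around the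
contracted vertex.  The half-edges [x0] and [y0] are only fixed up to reversal,
because [pentagon_flip_fst] reverses one of them. *)
Definition pentagon_ccw n v x0 y0 u1 u2 u3 u4 u5 :=
  exists x y c d e f z,
  [/\ pentagon_at n v x y c d e f z,
      [/\ v c = u1, v d = u2, v e = u3, v f = u4 & v z = u5],
      same_edge x0 x & same_edge y0 y].

Definition pentagon_cw n v x0 y0 u1 u2 u3 u4 u5 :=
  pentagon_ccw n v y0 x0 u1 u2 u3 u4 u5.

Lemma pentagon_sum n v x y u1 u2 u3 u4 u5 :
  pentagon_ccw n v x y u1 u2 u3 u4 u5 -> u1 + u2 + u3 + u4 + u5 = 0.
Proof.
case=> x1 [y1 [c [d [e [f [z [P [<- <- <- <- <-] _ _]]]]]]].
have [/square_label[_ s1] /square_label[_ s2]] := pentagon_squares P.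
by rewrite s1 -[_ + v f]addrA s2; case: P => _ [[]].
Qed.

Lemma pentagon_ccw_step n v x y u1 u2 u3 u4 u5 :
  pentagon_ccw n v x y u1 u2 u3 u4 u5 ->
  flip_value n v x = F (u3 + u4) u5 u1 u2 /\
  pentagon_ccw (flip_nxt bar n x) (flip_label n x v) y x u3 u4 u5 u1 u2.
Proof.
case=> x1 [y1 [c [d [e [f [z [P [<- <- <- <- <-] xE yE]]]]]]].
have [sx /square_label[_ ->]] := pentagon_squares P; split.
  exact: flip_value_square sx xE.
exists y1, (bar x1), e, f, z, c, d; split=> //.
- exact: pentagon_flip_fst.
- by case: P => U _ _; move: U; split_neq => _;
    split; rewrite (flip_label_far _ _ xE); by_neq.
- by rewrite /same_edge barK or_comm.
Qed.

(** The square around the second edge has labels [u5], [u1 + u2], [u3], [u4]; a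
quarter turn gives the form that occurs in the pentagon relation. *)
Lemma pentagon_cw_step n v x y u1 u2 u3 u4 u5 :
  pentagon_cw n v x y u1 u2 u3 u4 u5 ->
  flip_value n v x = - F (u1 + u2) u3 u4 u5 /\
  pentagon_cw (flip_nxt bar n x) (flip_label n x v) y x u4 u5 u1 u2 u3.
Proof.
case=> x1 [y1 [c [d [e [f [z [P [<- <- <- <- <-] xE yE]]]]]]].
have [/square_label[_ ->] sy] := pentagon_squares P; split.
  by rewrite F_rot ?opprK; [exact: flip_value_square sy yE | exact: square_sum sy].
exists y1, x1, f, z, c, d, e; split=> //.
- exact: pentagon_flip_snd.
- by case: P => U _ _; move: U; split_neq => _;
    split; rewrite (flip_label_far _ _ yE); by_neq.
Qed.

Lemma pentagon_ccw_alternate_sum n v x y u1 u2 u3 u4 u5 :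
  pentagon_ccw n v x y u1 u2 u3 u4 u5 -> alternate_sum 5 n v x y = 0.
Proof.
move=> P; have s := pentagon_sum P; move: P.
case/pentagon_ccw_step=> /= -> /pentagon_ccw_step[-> /pentagon_ccw_step[->]].
case/pentagon_ccw_step=> -> /pentagon_ccw_step[-> _].
rewrite addr0 -(F_pent s) !addrA.
by rewrite (AC 5 (5*1*2*3*4)).
Qed.

Lemma pentagon_cw_alternate_sum n v x y u1 u2 u3 u4 u5 :
  pentagon_cw n v x y u1 u2 u3 u4 u5 -> alternate_sum 5 n v x y = 0.
Proof.
move=> P; have s := pentagon_sum P; move: P.
case/pentagon_cw_step=> /= -> /pentagon_cw_step[-> /pentagon_cw_step[->]].
case/pentagon_cw_step=> -> /pentagon_cw_step[-> _].
rewrite addr0 -[RHS]oppr0 -(F_pent s) !opprD !addrA.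
by rewrite (AC 5 (1*5*4*3*2)).
Qed.

End Cochain.

End LocalFlips.

(** * Labels on a trivalent spine *)

Lemma uniq_orbits (D : finType) (f : D -> D) (s : seq D) : injective f ->
  pairwise (fun u v => ~~ fconnect f u v) s ->
  uniq (flatten [seq orbit f u | u <- s]).
Proof.
move=> fI; elim: s => //= u s IH /andP[us ps].
rewrite cat_uniq orbit_uniq IH // andbT /=; apply/hasPn => h /flattenP[o].
case/mapP=> v vs ->; rewrite -!fconnect_orbit => vh; apply/negP => /= uh.
have /negP := allP us v vs; apply; apply: connect_trans uh _.
by rewrite fconnect_sym.
Qed.

(** Orients both edges towards their unique common endpoint. *)
Lemma shared1_ends (D : finType) (bar nxt : D -> D) (x y : D) :
  involutive bar -> shared bar nxt x y = 1%N ->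
  exists x1 y1, [/\ same_edge bar x x1, same_edge bar y y1, fconnect nxt x1 y1 &
    [/\ ~~ fconnect nxt x1 (bar y1), ~~ fconnect nxt (bar x1) y1
      & ~~ fconnect nxt (bar x1) (bar y1)]].
Proof.
move=> bK; rewrite /shared /=.
case xy: (fconnect nxt x y); case xY: (fconnect nxt x (bar y));
  case Xy: (fconnect nxt (bar x) y); case XY: (fconnect nxt (bar x) (bar y)) => // _.
- by exists x, y; rewrite xy xY Xy XY; split=> //; left.
- by exists x, (bar y); rewrite bK xy xY Xy XY; split=> //; [left|right; rewrite bK].
- by exists (bar x), y; rewrite bK xy xY Xy XY; split=> //; [right; rewrite bK|left].
- exists (bar x), (bar y); rewrite !bK xy xY Xy XY.
  by split=> //; right; rewrite bK.
Qed.

Section Labels.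
Variables (g : nat) (K : zmodType) (p : surface_group g -> K).
Hypothesis pM : {morph p : x y / (x * y)%g >-> x + y}.

Lemma label1 : p 1%g = 0.
Proof. by apply: (addIr (p 1%g)); rewrite -pM mulg1 add0r. Qed.

Lemma labelV x : p x^-1%g = - p x.
Proof. by apply/eqP; rewrite -addr_eq0 -pM mulVg label1. Qed.

Lemma dart_value_bar (G : spine g) (e : dart G) :
  dart_value p (bar e) = - dart_value p e.
Proof. by rewrite /dart_value mark_bar labelV. Qed.

Section Trivalent.
Variable G : tspine g.

Lemma nxt3 (e : dart G) : e != tail -> nxt (nxt (nxt e)) = e /\ nxt e != e.
Proof. exact: (trivP (@nxt_inj G) (@tspine_trivalent g G)). Qed.

Lemma orbit3 (e : dart G) : e != tail -> orbit nxt e = [:: e; nxt e; nxt (nxt e)].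
Proof. by case/nxt3=> n3 n1; case: (order3 (@nxt_inj G) n3 n1). Qed.

Lemma tripod_nxt (e : dart G) : e != tail ->
  tripod nxt (@dart_value g K p G) e (nxt e) (nxt (nxt e)).
Proof.
move=> et; have [n3 _] := nxt3 et; split=> //.
rewrite /dart_value -!pM -label1 -(mark_vertex et) orbit3 //.
by rewrite !big_cons big_nil mulg1 mulgA.
Qed.

Lemma flip_square (x : dart G) : flip_edge x ->
  square bar nxt (@dart_value g K p G) x (nxt x) (nxt (nxt x))
    (nxt (bar x)) (nxt (nxt (bar x))).
Proof.
case/and3P=> xt Xt xX; split; rewrite ?dart_value_bar //; try exact: tripod_nxt.
have := @uniq_orbits _ nxt [:: x; bar x] (@nxt_inj G).
rewrite /= xX cats0 !orbit3 // => /(_ isT) U.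
by uniq_of U.
Qed.

Lemma adjacent_pentagon (x y : dart G) :
  x != tail -> bar x != tail -> bar y != tail -> nxt x = y ->
  ~~ fconnect nxt x (bar x) -> ~~ fconnect nxt x (bar y) ->
  ~~ fconnect nxt (bar x) (bar y) ->
  pentagon_at bar nxt (@dart_value g K p G) x y (nxt (bar x)) (nxt (nxt (bar x)))
     (nxt (bar y)) (nxt (nxt (bar y))) (nxt y).
Proof.
move=> xt Xt Yt xy xX xY XY; split; last by rewrite !dart_value_bar.
  have := @uniq_orbits _ nxt [:: x; bar x; bar y] (@nxt_inj G).
  rewrite /= xX xY XY cats0 !orbit3 // xy => /(_ isT) U.
  by uniq_of U.
by split; [rewrite -xy| |]; apply: tripod_nxt.
Qed.

Lemma disjoint_flips_squares_at (x y : dart G) : flip_edge x -> flip_edge y ->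
  shared bar nxt x y = 0%N ->
  squares_at bar nxt (@dart_value g K p G) x (nxt x) (nxt (nxt x))
    (nxt (bar x)) (nxt (nxt (bar x))) y (nxt y) (nxt (nxt y))
    (nxt (bar y)) (nxt (nxt (bar y))).
Proof.
move=> fx fy xy0; split; last by split; apply: flip_square.
case/and3P: fx fy => xt Xt xX /and3P[yt Yt yY].
have := @uniq_orbits _ nxt [:: x; bar x; y; bar y] (@nxt_inj G).
move: xy0; rewrite /shared /=.
case: (fconnect nxt x y); case: (fconnect nxt x (bar y));
  case: (fconnect nxt (bar x) y); case: (fconnect nxt (bar x) (bar y)) => // _.
rewrite xX yY cats0 !orbit3 // => /(_ isT) U.
by uniq_of U.
Qed.

End Trivalent.
End Labels.

(** * The cochain attached to a function of four labels *)

Section Complex.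
Variables (g : nat) (K : zmodType) (p : surface_group g -> K).
Hypothesis pM : {morph p : x y / (x * y)%g >-> x + y}.
Variables (A : zmodType) (F : K -> K -> K -> K -> A).

Definition flip_eval (W : flip g) : A :=
  F (dart_value p (half_a W)) (dart_value p (half_b W))
    (dart_value p (half_c W)) (dart_value p (half_d W)).

Lemma dart_value_flip (G : tspine g) (x : dart G) (fx : flip_edge x) :
  @dart_value g K p (flip_target fx) = flip_label bar nxt x (@dart_value g K p G).
Proof.
apply/funext => h; rewrite /dart_value /flip_label /= /flip_mark.
by case: ifP => _; [rewrite pM | case: ifP => _; rewrite ?(labelV pM) ?pM].
Qed.

Lemma sum_pair_loop k (P : flip_pair g) :
  \sum_(W <- map (@pair_flip g) (traject (@pair_step g) P k)) flip_eval W =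
  alternate_sum bar F k nxt (@dart_value g K p (pair_src P))
    (pair_fst P) (pair_snd P).
Proof.
elim: k P => [|k IH] P; first by rewrite big_nil.
rewrite /= big_cons IH; congr (_ + _).
by rewrite [in LHS]dart_value_flip.
Qed.

Hypothesis F_rot : quarter_turn_skew F.
Hypothesis F_pent : pentagon_relation F.

(** Two edges sharing one endpoint at a trivalent vertex are adjacent there in
exactly one of two ways; which of them decides the sense in which the loop runs
around the pentagon. *)
Lemma pair_loop_sum0 (P : flip_pair g) : \sum_(W <- pair_loop P) flip_eval W = 0.
Proof.
rewrite /pair_loop sum_pair_loop.
have [xt Xt xX] := and3P (pair_fst_ok P); have [yt Yt yY] := and3P (pair_snd_ok P).
case: eqP => [sh|/eqP sh].
  apply: (disjoint_squares_alternate_sum (@barK _) F_rot).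
  have sq := disjoint_flips_squares_at pM (pair_fst_ok P) (pair_snd_ok P) sh.
  by do 10![eexists]; split; [exact: sq | by [] | by [] | left | left].
have {}sh : shared bar nxt (pair_fst P) (pair_snd P) = 1%N.
  by move: (pair_shared P) sh; case: shared => [|[|]].
have [x [y [xE yE xy [xY Xy XY]]]] := shared1_ends (@barK _) sh.
have fc := fconnect_sym (@nxt_inj (pair_src P)).
have nt (u v : dart (pair_src P)) : same_edge bar u v ->
    u != tail -> bar u != tail -> v != tail /\ bar v != tail.
  by case=> ->; rewrite ?barK.
have [{}xt {}Xt] := nt _ _ xE xt Xt; have [{}yt {}Yt] := nt _ _ yE yt Yt.
have ne (u v : dart (pair_src P)) : same_edge bar u v ->
    ~~ fconnect nxt u (bar u) -> ~~ fconnect nxt v (bar v).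
  by case=> ->; rewrite ?barK // fc.
have {}xX := ne _ _ xE xX; have {}yY := ne _ _ yE yY.
move: xy; rewrite fconnect_orbit orbit3 // !inE => /or3P[] /eqP yx.
- by move: XY; rewrite yx connect0.
- have := adjacent_pentagon pM xt Xt Yt (esym yx) xX xY XY => pent.
  apply: (pentagon_ccw_alternate_sum (@barK _) F_rot F_pent).
  by do 7![eexists]; split; [exact: pent | split | |].
- have [n3 _] := nxt3 xt; have yx' : nxt y = x by rewrite yx.
  rewrite fc in Xy; rewrite fc in XY.
  have := adjacent_pentagon pM yt Yt Xt yx' yY Xy XY => pent.
  apply: (pentagon_cw_alternate_sum (@barK _) F_rot F_pent).
  by do 7![eexists]; split; [exact: pent | split | |].
Qed.

Lemma flip_eval_iso (V W : flip g) : flip_eq V W -> flip_eval V = flip_eval W.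
Proof.
case=> f fx; have sq := flip_square pM (flip_ok W).
transitivity (flip_value bar F nxt (@dart_value g K p (flip_src W)) (f (flip_dart V))).
  by rewrite /flip_value -!iso_bar -!iso_nxt /dart_value !iso_mark.
rewrite (flip_value_square (@barK _) F_rot sq fx).
by rewrite -(flip_value_square (@barK _) F_rot sq (or_introl erefl)).
Qed.

Definition flip_cochain (e : edge (dual_complex g)) : A := flip_eval (class_repr e).

Lemma flip_cochain_class (W : flip g) : flip_cochain (flip_class W) = flip_eval W.
Proof.
rewrite /flip_cochain; apply/esym/flip_eval_iso; rewrite /class_repr.
case: cid => V /= E.
have : flip_eq V V.
  exists (@SpineIso _ _ _ id (inv_bij (fun=> erefl)) (fun=> erefl) (fun=> erefl)
     erefl (fun=> erefl)); by left.
by rewrite -[X in X -> _]/((fun w => flip_eq V w) V) -E.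
Qed.

(** The reverse flip sees the half-edges [b], [c], [d], [a]. *)
Lemma flip_eval_inv (W : flip g) : flip_eval (flip_inv W) = - flip_eval W.
Proof.
have sq := flip_square pM (flip_ok W).
rewrite -[RHS]F_rot; last exact: square_sum sq.
have fx : same_edge bar (flip_dart W) (flip_dart W) by left.
have := flip_value_square (@barK _) F_rot (square_flip (@barK _) sq fx) fx.
case: sq => U _ _ _; move: U; split_neq => _.
rewrite -(dart_value_flip (flip_ok W)) => E; apply: etrans E _.
by rewrite (dart_value_flip (flip_ok W)) !(flip_label_far (@barK _) _ _ fx) //; by_neq.
Qed.

Lemma flip_cochain_cocycle : cocycle flip_cochain.
Proof.
split=> [e|w [P ->]]; first by rewrite /= flip_cochain_class flip_eval_inv.
rewrite big_map -[RHS](pair_loop_sum0 P).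
by apply: eq_bigr => W _; exact: flip_cochain_class.
Qed.

Lemma flip_eval_act (phi : mapping_class g) (t : K -> K) (Ft : A -> A) :
  (forall a b c d, F (t a) (t b) (t c) (t d) = Ft (F a b c d)) ->
  p \o phi = t \o p -> forall e, flip_cochain (act_edge phi e) = Ft (flip_cochain e).
Proof.
move=> FE pE e; rewrite flip_cochain_class -FE.
have E (G : spine g) (h : dart G) : p (phi (mark h)) = t (dart_value p h).
  exact: (congr1 (fun q => q (mark h)) pE).
by rewrite /flip_eval /dart_value /= !E.
Qed.

Lemma flip_cochain_descends : descends p flip_cochain.
Proof.
have inv phi e : MC_nabla p phi -> flip_cochain (act_edge phi e) = flip_cochain e.
  by move=> pphi; apply: (@flip_eval_act phi id id).
have repr_class e : flip_cochain (class_repr (nabla_proj p e)) = flip_cochain e.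
  rewrite /class_repr; case: cid => e' /= E.
  (* The class of [e] is known only as the set of its translates; the translate
     by the identity lies in both descriptions of it. *)
  pose one := @MappingClass g id (fun _ _ => erefl) (inv_bij (fun=> erefl)) erefl.
  have /= oneE := congr1 (fun R => R (act_edge one e)) E.
  have [phi pphi phiE] :
      exists2 phi, MC_nabla p phi & act_edge phi e' = act_edge one e.
    by rewrite -oneE; exists one.
  by rewrite -(inv phi e') // phiE; apply: inv.
exists (fun C => flip_cochain (class_repr C)); split; last exact/funext.
have [cN cL] := flip_cochain_cocycle.
split=> [C|w [w' /cL s <-]]; first by rewrite repr_class cN.
by rewrite big_map -[RHS]s; apply: eq_bigr => e _; exact: repr_class.
Qed.

(** Since [phi] preserves the kernel of [p] in both directions, it induces an
automorphism of the quotient [K]. *)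
Lemma box_induced (p_surj : forall k, exists x, p x = k) phi : MC_box p phi ->
  exists t : {additive K -> K}, bijective t /\ p \o phi = t \o p.
Proof.
move=> box.
have ker x : p (phi x) = 0 <-> p x = 0.
  split=> [px|px].
    have : [set x | p x = 0]%classic (phi x) by [].
    rewrite -box => -[y /= py]; have [psi phiK _] := mc_bij phi.
    by move=> /(can_inj phiK) <-.
  have : (phi @` [set x | p x = 0])%classic (phi x) by exists x.
  by rewrite box.
have eq_ker x y : p x = p y <-> p (phi x) = p (phi y).
  have E u v : p u = p v <-> p (u * v^-1)%g = 0.
    rewrite pM (labelV pM); split=> [->|/eqP]; first by rewrite subrr.
    by rewrite subr_eq0 => /eqP.
  by rewrite E -ker mc_mul mcV -E.
pose lift k := projT1 (cid (p_surj k)).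
have liftK k : p (lift k) = k by rewrite /lift; case: cid.
pose t k := p (phi (lift k)).
have tp x : t (p x) = p (phi x) by apply: (proj1 (eq_ker _ _)); rewrite liftK.
have tB : zmod_morphism t.
  move=> x y; rewrite -[x]liftK -[y]liftK -(labelV pM) -pM !tp.
  by rewrite mc_mul mcV pM (labelV pM).
pose tA := GRing.isZmodMorphism.Build K K t tB.
pose T : {additive K -> K} := HB.pack t tA.
exists T; split; last by apply/funext => x /=; rewrite tp.
have [psi phiK psiK] := mc_bij phi.
exists (fun k => p (psi (lift k))) => k /=.
  rewrite -[RHS]liftK; apply: (proj2 (eq_ker _ _)).
  by rewrite psiK liftK.
by rewrite tp psiK.
Qed.

End Complex.

(** * Exterior and symmetric products *)

Section AlternatingMaps.
Variables (U V : zmodType).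

Lemma additive0 (f : U -> V) : {morph f : x y / x + y} -> f 0 = 0.
Proof. by move=> fD; apply: (addIr (f 0)); rewrite -fD !add0r. Qed.

Lemma additiveN (f : U -> V) x : {morph f : x y / x + y} -> f (- x) = - f x.
Proof. by move=> fD; apply/eqP; rewrite -addr_eq0 -fD addNr additive0. Qed.

Lemma alternating_skew (f : U -> U -> V) x y :
  (forall y, {morph f ^~ y : x x' / x + x'}) ->
  (forall x, {morph f x : y y' / y + y'}) ->
  (forall x, f x x = 0) -> f y x = - f x y.
Proof.
move=> fDl fDr fxx; apply/eqP; rewrite -addr_eq0 -(fxx (x + y)).
by rewrite fDl !fDr !fxx add0r addr0 addrC.
Qed.

End AlternatingMaps.

Section Wedges.
Variable K : zmodType.

Let substE n (s : seq K) (i : 'I_n) (x : K) (s' : seq K) :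
  (forall k : 'I_n, (if k == i then x else s`_k) = s'`_k) ->
  subst [ffun k : 'I_n => s`_k] i x = [ffun k : 'I_n => s'`_k].
Proof. by move=> E; apply/ffunP => k; rewrite !ffunE. Qed.

Lemma wedge2Dl (y : K) : {morph (@wedge2 K)^~ y : x x' / x + x'}.
Proof.
move=> x x'.
have E z : [ffun i : 'I_2 => [:: z; y]`_i] =
    subst [ffun i : 'I_2 => [:: 0; y]`_i] ord0 z.
  by apply/esym/substE => -[[|[|]]].
by rewrite /wedge2 (E x) (E x') (E (x + x')) wedgeD.
Qed.

Lemma wedge2Dr (x : K) : {morph (@wedge2 K x) : y y' / y + y'}.
Proof.
move=> y y'.
have E z : [ffun i : 'I_2 => [:: x; z]`_i] =
    subst [ffun i : 'I_2 => [:: x; 0]`_i] (inord 1) z.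
  by apply/esym/substE => -[[|[|]]] //= lt; rewrite -val_eqE /= inordK.
by rewrite /wedge2 (E y) (E y') (E (y + y')) wedgeD.
Qed.

Lemma wedge2_alt (x : K) : wedge2 x x = 0.
Proof. by apply: (@wedge_alt _ _ _ ord0 ord_max); rewrite // !ffunE. Qed.

Lemma wedge2C (x y : K) : wedge2 y x = - wedge2 x y.
Proof. exact: (@alternating_skew _ _ _ x y wedge2Dl wedge2Dr wedge2_alt). Qed.

Lemma wedge3D1 (y z : K) : {morph (fun x => wedge3 x y z) : x x' / x + x'}.
Proof.
move=> x x'.
have E u : [ffun i : 'I_3 => [:: u; y; z]`_i] =
    subst [ffun i : 'I_3 => [:: 0; y; z]`_i] ord0 u.
  by apply/esym/substE => -[[|[|[|]]]].
by rewrite /wedge3 (E x) (E x') (E (x + x')) wedgeD.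
Qed.

Lemma wedge3D2 (x z : K) : {morph (fun y => wedge3 x y z) : y y' / y + y'}.
Proof.
move=> y y'.
have E u : [ffun i : 'I_3 => [:: x; u; z]`_i] =
    subst [ffun i : 'I_3 => [:: x; 0; z]`_i] (inord 1) u.
  by apply/esym/substE => -[[|[|[|]]]] //= lt; rewrite -val_eqE /= inordK.
by rewrite /wedge3 (E y) (E y') (E (y + y')) wedgeD.
Qed.

Lemma wedge3D3 (x y : K) : {morph (@wedge3 K x y) : z z' / z + z'}.
Proof.
move=> z z'.
have E u : [ffun i : 'I_3 => [:: x; y; u]`_i] =
    subst [ffun i : 'I_3 => [:: x; y; 0]`_i] ord_max u.
  by apply/esym/substE => -[[|[|[|]]]].
by rewrite /wedge3 (E z) (E z') (E (z + z')) wedgeD.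
Qed.

Lemma wedge3C12 (x y z : K) : wedge3 y x z = - wedge3 x y z.
Proof.
apply: (alternating_skew (f := fun x y => wedge3 x y z)) => [?|?|u].
- exact: wedge3D1.
- exact: wedge3D2.
- by apply: (@wedge_alt _ _ _ ord0 (inord 1)); rewrite ?ffunE -?val_eqE /= inordK.
Qed.

Lemma wedge3C23 (x y z : K) : wedge3 x z y = - wedge3 x y z.
Proof.
apply: (alternating_skew (f := wedge3 x)) => [?|?|u].
- exact: wedge3D2.
- exact: wedge3D3.
- by apply: (@wedge_alt _ _ _ (inord 1) ord_max); rewrite ?ffunE -?val_eqE /= inordK.
Qed.

Lemma wedge3_rot (x y z : K) : wedge3 y z x = wedge3 x y z.
Proof. by rewrite wedge3C23 wedge3C12 opprK. Qed.

Lemma wedge3_alt (x y : K) : wedge3 x x y = 0.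
Proof.
by apply: (@wedge_alt _ _ _ ord0 (inord 1)); rewrite ?ffunE -?val_eqE /= inordK.
Qed.

Lemma wedge3_alt23 (x y : K) : wedge3 x y y = 0.
Proof. by rewrite -wedge3_rot wedge3_alt. Qed.

Lemma wedge3_alt13 (x y : K) : wedge3 x y x = 0.
Proof. by rewrite wedge3_rot wedge3_alt. Qed.

(** Replace [a + b] by [- (e + c + d)]; a wedge with a repeated factor vanishes. *)
Lemma wedge3_sum0 (a b c d e : K) : a + b + c + d + e = 0 ->
  wedge3 (a + b) c d = - wedge3 e c d.
Proof.
move=> s; have -> : a + b = - (e + c + d).
  by apply/eqP; rewrite -addr_eq0 -s (AC (2*3) (1*2*4*5*3)).
rewrite (additiveN _ (wedge3D1 c d)) !wedge3D1.
by rewrite wedge3_alt wedge3_alt13 !addr0.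
Qed.

Lemma sym_prodC (u v : ext 2 K) : sym_prod u v = sym_prod v u.
Proof. by apply: val_inj; rewrite /= addrC. Qed.

Lemma sym_prodDl (v : ext 2 K) : {morph (@sym_prod (ext 2 K))^~ v : u u' / u + u'}.
Proof. by move=> u u'; apply: val_inj; rewrite /= tensDl tensDr addrACA. Qed.

End Wedges.

(** * The three functions *)

Section Cochains.
Variable K : zmodType.
Implicit Types a b c d e : K.

Definition m_form a b c d : K := a + c.
Definition j_form a b c d : ext 3 K := wedge3 a b c.
Definition s_form a b c d : sym_tensor (ext 2 K) := sym_prod (wedge2 a c) (wedge2 b d).

Lemma m_rot : quarter_turn_skew m_form.
Proof.
by move=> a b c d s; apply/eqP; rewrite -addr_eq0 /m_form -s (AC (2*2) (3*1*4*2)).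
Qed.

Lemma m_pent : pentagon_relation m_form.
Proof.
move=> a b c d e s; rewrite /m_form.
rewrite (AC (3*3*3*3*3) ((1*2*4*3*7)*(6*10*9*5*12)*(8*15*11*13*14))).
by rewrite /= s !add0r.
Qed.

Lemma j_rot : quarter_turn_skew j_form.
Proof.
move=> a b c d s; rewrite /j_form (wedge3_rot d b c) -[in LHS](addr0 d).
by apply: wedge3_sum0; rewrite addr0 -s (AC 4 (4*2*3*1)).
Qed.

(** By [wedge3_sum0] each term becomes the wedge of three consecutive labels, up to
sign; in the sum of these five, eliminating [e] leaves nothing. *)
Lemma j_pent : pentagon_relation j_form.
Proof.
move=> a b c d e s; rewrite /j_form (wedge3_sum0 s).
rewrite (@wedge3_sum0 _ c d e a b); last by rewrite -s (AC 5 (4*5*1*2*3)).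
rewrite (@wedge3_sum0 _ e a b c d); last by rewrite -s (AC 5 (2*3*4*5*1)).
rewrite (@wedge3_sum0 _ b c d e a); last by rewrite -s (AC 5 (5*1*2*3*4)).
rewrite (@wedge3_sum0 _ d e a b c); last by rewrite -s (AC 5 (3*4*5*1*2)).
have eE x y :
    wedge3 x y e = - (wedge3 x y a + wedge3 x y b + wedge3 x y c + wedge3 x y d).
  apply/eqP; rewrite -addr_eq0 addrC -!wedge3D3 s.
  by rewrite (additive0 (wedge3D3 x y)).
rewrite -(wedge3_rot e c d) (wedge3_rot a b e) !eE.
rewrite !wedge3_alt23 !wedge3_alt13 !addr0 !add0r !opprK.
rewrite (wedge3_rot a c d) (wedge3_rot b c d) (wedge3C23 a b d) (wedge3C23 a c d).
rewrite -(wedge3_rot d b c) -(wedge3_rot c a b).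
rewrite (AC ((2*2)*1*2*1) ((1*7)*(2*5)*(3*8)*(4*6))).
by rewrite /= !subrr !addr0.
Qed.

Lemma s_rot : quarter_turn_skew s_form.
Proof.
move=> a b c d _; rewrite /s_form [wedge2 c a]wedge2C sym_prodC.
exact: (additiveN _ (sym_prodDl _)).
Qed.

(** Each term splits into two products of wedges of labels, and the five pairs of
equal products that arise have opposite signs. *)
Lemma s_pent : pentagon_relation s_form.
Proof.
move=> a b c d e _; pose q x y z t := sym_prod (@wedge2 K x y) (wedge2 z t).
have qC x y z t : q z t x y = q x y z t by rewrite /q sym_prodC.
have qN x y z t : q y x z t = - q x y z t.
  by rewrite /q wedge2C (additiveN _ (sym_prodDl _)).
have qD x y z t u : s_form (x + y) z t u = q x t z u + q y t z u.
  by rewrite /s_form wedge2Dl sym_prodDl.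
rewrite !qD (qC d a c e) (qN a d c e) (qN c e b d) (qC b d c e) (qC a c e b).
rewrite (qN c a e b) (qN e b d a) (qC d a e b) (qN b d a c) (qC a c b d).
rewrite (AC (2*2*2*2*2) ((1*8)*(2*5)*(3*10)*(4*7)*(6*9))).
by rewrite /= !subrr !addr0.
Qed.

End Cochains.

Theorem theorem3p3 (g : nat) (hg : (0 < g)%N) (K : zmodType)
    (p : surface_group g -> K) (hp : is_marking p) :
  exists (m : edge (dual_complex g) -> K)
         (j : edge (dual_complex g) -> ext 3 K)
         (s : edge (dual_complex g) -> sym_tensor (ext 2 K)),
    [/\ forall W : flip g, m (flip_class W) = m_value p W,
        forall W : flip g, j (flip_class W) = j_value p W
      & forall W : flip g, s (flip_class W) = s_value p W] /\
    [/\ cocycle m, cocycle j & cocycle s] /\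
    [/\ box_equivariant p (fun t : {additive K -> K} => t : K -> K) m,
        box_equivariant p (fun t : {additive K -> K} => @ext_map 3 K K t) j
      & box_equivariant p
          (fun t : {additive K -> K} => sym_map (@ext_map 2 K K t)) s] /\
    [/\ descends p m, descends p j & descends p s].
Proof.
have [pM p_surj] := hp.
exists (flip_cochain p (@m_form K)), (flip_cochain p (@j_form K)),
  (flip_cochain p (@s_form K)); split; [|split; [|split]].
- split=> W; apply: flip_cochain_class => //.
  + exact: m_rot.
  + exact: j_rot.
  + exact: s_rot.
- split; apply: flip_cochain_cocycle => //.
  + exact: m_rot.
  + exact: m_pent.
  + exact: j_rot.
  + exact: j_pent.
  + exact: s_rot.
  + exact: s_pent.
- split=> phi /(box_induced pM p_surj)[t [tbij pt]]; exists t; split=> // e.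
  + apply: (flip_eval_act pM (@m_rot K) _ pt) => a b c d.
    by rewrite /m_form raddfD.
  + apply: (flip_eval_act pM (@j_rot K) _ pt) => a b c d.
    rewrite /j_form /wedge3 ext_map_wedge; congr wedge.
    by apply/ffunP => -[[|[|[|]]] ?] //; rewrite !ffunE.
  + apply: (flip_eval_act pM (@s_rot K) _ pt) => a b c d.
    have w2 x y : ext_map t (wedge2 x y) = wedge2 (t x) (t y).
      rewrite /wedge2 ext_map_wedge; congr wedge.
      by apply/ffunP => -[[|[|]] ?] //; rewrite !ffunE.
    by apply: val_inj; rewrite /= raddfD /= !tensor_map_tens /= !w2.
- split; apply: flip_cochain_descends => //.
  + exact: m_rot.
  + exact: m_pent.
  + exact: j_rot.
  + exact: j_pent.
  + exact: s_rot.
  + exact: s_pent.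
Qed.
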